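(* Let $p$ be a prime, let $G$ be a finite $p$-group and let $N$ be a non-trivial normal subgroup of $G$ such that $G/N$ is not cyclic. Suppose that one of the following holds: (1) $p>2$ and $G/Z(G)$ is either nilpotent of class at most $2$ or $p$-central; (2) $G$ is nilpotent of class at most $2$. Then the Tate cohomology groups satisfy $H^n(G/N,Z(N))\neq 0$ for all integers $n\ge 0$.
   Context: A finite $p$-group $P$ is called $p$-central if $\Omega_1(P)=\Omega_1(Z(P))$, where $\Omega_1(P)$ is the subgroup generated by the elements of order $p$ of $P$; equivalently, all elements of order $p$ in $P$ are central. For $N$ normal in $G$, $Z(N)$ is regarded as a right $G/N$-module via $a^{gN}=a^g=g^{-1}ag$ for $a\in Z(N)$, $g\in G$. $H^n(Q,A)$ denotes Tate cohomology of the finite group $Q$ with coefficients in the $Q$-module $A$; in particular $H^0(Q,A)=A_Q/A^\tau$, where $A_Q$ is the subgroup of $Q$-fixed points of $A$ and $A^\tau$ is the image of the trace map $a\mapsto a\sum_{x\in Q}x$, and for $n\ge 1$ it is ordinary group cohomology. *)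

(* Defs.v *)
From HB Require Import structures.
From mathcomp Require Import all_boot all_fingroup all_solvable.

Set Implicit Arguments.
Unset Strict Implicit.
Unset Printing Implicit Defensive.

Local Open Scope group_scope.

Definition p_central (gT : finGroupType) (p : nat) (P : {set gT}) : bool :=
  p.-group P && ('Ohm_1(P) == 'Ohm_1('Z(P))).

Definition nil_class_le (gT : finGroupType) (c : nat) (P : {set gT}) : bool :=
  nilpotent P && (nil_class P <= c).

(* Tate cohomology, in non-negative degrees, of a subgroup Q of D with
   coefficients in the right Q-module A, written multiplicatively: A is an
   abelian subgroup of R, stable under the action of Q through to. *)
Section TateCohomology.

Variables (aT rT : finGroupType) (D : {group aT}) (R : {group rT}).
Variable to : groupAction D R.
Variables (Q : {group aT}) (A : {group rT}).

(* Maps Q^n -> A, extended by 1 to tuples that are not in Q^n; the group law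
   is the pointwise one. *)
Definition cochains (n : nat) : {group {dffun forall _ : n.-tuple aT, rT}} :=
  setXn_group (fun t : n.-tuple aT => if all [in Q] t then A else 1%G).

(* (x_0, .., x_n) |-> (x_1, .., x_n)                        for i = 0,
                      (x_0, .., x_(i-1) x_i, .., x_n)   for 0 < i <= n,
                      (x_0, .., x_(n-1))                    for i = n+1. *)
Definition face (n : nat) (i : 'I_n.+2) (t : n.+1.-tuple aT) : n.-tuple aT :=
  [tuple let x := tnth t (widen_ord (leqnSn n) j) in
         let y := tnth t (lift ord0 j) in
         if j.+1 < i then x else if j.+1 == i then x * y else y | j < n].

Definition alternate (i : nat) (a : rT) : rT := if odd i then a^-1 else a.

(* As the action is on the right, it is the last face that is twisted:
   (d f)(x, y) = f(y) f(xy)^-1 f(x)^y in degree 1. *)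
Definition differential (n : nat) (f : {dffun forall _ : n.-tuple aT, rT}) :
    {dffun forall _ : n.+1.-tuple aT, rT} :=
  [ffun t : n.+1.-tuple aT =>
    if all [in Q] t then
      (\prod_(i < n.+1) alternate i (f (face (widen_ord (leqnSn n.+1) i) t)))
      * alternate n.+1 (to (f (face ord_max t)) (tnth t ord_max))
    else 1].

Definition cocycles (n : nat) : {set {dffun forall _ : n.-tuple aT, rT}} :=
  [set f in cochains n | differential f == 1].

Definition coboundaries (n : nat) :
    {set {dffun forall _ : n.+1.-tuple aT, rT}} :=
  [set differential f | f in cochains n].

Definition trace_image : {set rT} :=
  [set \prod_(x in Q) to a x | a in A].

Definition tate_type (n : nat) : finGroupType :=
  if n is m.+1 then coset_of (coboundaries m) else coset_of trace_image.

Definition tate_cohomology (n : nat) : {set tate_type n} :=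
  match n return {set tate_type n} with
  | 0 => 'Fix_(A | to)(Q) / trace_image
  | m.+1 => cocycles m.+1 / coboundaries m
  end.

End TateCohomology.

(* The action of G / N on 'Z(N) by conjugation is 'J %% N. *)
Lemma conj_mod_centerE (gT : finGroupType) (G N : {group gT}) (a g : gT) :
  N <| G -> a \in 'Z(N) -> g \in G -> ('J %% N)%gact a (coset N g) = a ^ g.
Proof.
move=> nNG /centerP[_ cNa] Gg; have Ng := subsetP (normal_norm nNG) g Gg.
rewrite /= modactE ?in_setT //; apply/afixP=> x /setIP[_ Nx] /=.
by rewrite /conjg cNa // mulKg.
Qed.

(* Main.v *)
From HB Require Import structures.
Require Import Defs.
From mathcomp Require Import all_boot all_fingroup all_solvable all_algebra.

(** Write Q = G/N and M = Z(N), additively. The proof assumes that H^n(Q, M)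
    vanishes for one n >= 0 and concludes that M = 0; a p-group with trivial
    center being trivial, this contradicts N <> 1.

    The first half shows that H^0(K, M) = 0 for every subgroup K of Q: for
    finite modules of p-power order over a p-group, vanishing in one degree
    forces cohomological triviality (Gaschuetz, Uchida). Only H^0 is needed,
    because H^n(K, M) = H^0(K, Z_n), where Z_n is the image of the n-th
    differential of the coinduced resolution M -> C_1 -> C_2 -> ... by
    homogeneous cochains ([tate0_of_tate_cohomology]). If H^0(Q, Z_n) = 0, then
    H^0(K, Z_n) = 0 for all K, by descent along maximal subgroups
    ([tate0_sub]). Dimension shifting then lowers n ([tate0_shift]): when a
    kernel Z sits in a module C with an image I and H^0(K, C) = H^0(K, I) = 0
    for all K, also H^0(K, Z) = 0 for all K. Both steps reduce to the cyclic
    group of order p that a maximal subgroup leaves as quotient, where the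
    Herbrand quotient of a finite module is 1 ([herbrand]).

    The second half plays this against the structure of G, which says how fast
    the operators [delta u] = u - 1 kill M. Let E = <x> x <y> be elementary
    abelian of order p^2 in Q; it exists as Q is not cyclic, if p is odd or Q
    is abelian.

    - If G/Z(G) has class at most 2 and p > 2, a product of three such operators
      is zero. Expanding (1 + (x - 1))^p = 1 shows that p(x - 1) = p(y - 1) = 0,
      so that p M is fixed by E and the trace of E is multiplication by p^2.
      Hence p M is contained in p^2 M, so p M = 0, the trace of E is zero and
      E has no nonzero fixed point in M: M = 0 ([class3_zero]).
    - If G has class at most 2, a product of two such operators is zero. When Q
      is abelian the same argument works for all p. Otherwise the derived
      subgroup of Q acts trivially on M, and for z of order p in it
      H^0(<z>, M) = 0 says that M = p M, so M = 0 ([quadratic_zero]).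
    - If G/Z(G) is p-central and p > 2, the elements of order p of M lie in the
      second center of G, so that a product of two operators kills the
      p-torsion S of M. As H^1(E, M) = 0, the crossed homomorphisms from E
      to S are principal in M, and counting them gives S = 0
      ([quadratic_torsion_zero]). *)

Set Implicit Arguments.
Unset Strict Implicit.
Unset Printing Implicit Defensive.

Import GRing.Theory.

Local Open Scope ring_scope.

(** * Modules over a finite group *)

HB.instance Definition _ (I : finType) (M : finZmodType) :=
  GRing.Zmodule.on {ffun I -> M}.
HB.instance Definition _ (M1 M2 : finZmodType) := GRing.Zmodule.on (M1 * M2)%type.

Lemma expg_index (gT : finGroupType) (H K : {group gT}) c :
  (H <| K)%g -> c \in K -> (c ^+ #|K : H|%g)%g \in H.
Proof.
move=> nHK Kc; have Nc := subsetP (normal_norm nHK) _ Kc.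
have : (coset H c ^+ #|K : H|%g = 1)%g.
  apply/eqP; rewrite -order_dvdn -card_quotient ?normal_norm //.
  by rewrite order_dvdG ?mem_quotient.
by rewrite -morphX //= => /coset_idr -> //; rewrite groupX.
Qed.

Lemma card_image_kernel (M1 M2 : finZmodType) (A : {set M1}) (f : M1 -> M2) :
    zmod_closed A -> {in A &, {morph f : a b / a - b}} ->
  #|A| = (#|[set a in A | (f a == 0)%R]| * #|f @: A|)%N.
Proof.
move=> [A0 AB] fB; have fBE a b : a \in A -> b \in A -> f (a - b) = f a - f b.
  by move=> ? ?; apply: fB.
have f0 : f 0 = 0 by rewrite -[X in f X](subrr 0) fBE // subrr.
have AN a : a \in A -> - a \in A by move=> Aa; rewrite -sub0r AB.
have AD a b : a \in A -> b \in A -> a + b \in A.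
  by move=> Aa Ab; rewrite -[b]opprK AB ?AN.
rewrite -sum1_card (partition_big_imset f) /= mulnC -sum_nat_const.
apply: eq_bigr => _ /imsetP[a0 Aa0 ->]; rewrite sum1_card.
rewrite -(card_imset _ (addIr (- a0))); apply: eq_card => b.
rewrite inE; apply/imsetP/andP => [[a /andP[Aa /eqP fa] ->] | [Ab /eqP fb]].
  by rewrite AB // fBE // fa subrr.
exists (b + a0); last by rewrite addrK.
rewrite unfold_in AD //=; have := fBE (b + a0) a0 (AD _ _ Ab Aa0) Aa0.
by rewrite addrK fb => /esym/eqP; rewrite subr_eq0.
Qed.

Record gmodule (qT : finGroupType) := GModule {
  gcarrier :> finZmodType;
  gmact : gcarrier -> qT -> gcarrier;
  gmact1 : forall m, gmact m 1%g = m;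
  gmactM : forall m x y, gmact m (x * y)%g = gmact (gmact m x) y;
  gmactD : forall x, {morph gmact^~ x : m n / m + n} }.

Notation "m ^^ x" := (gmact m x) (at level 29, left associativity).

Section Action.

Variables (qT : finGroupType) (M : gmodule qT).
Implicit Types (m : M) (x y : qT).

Lemma gmact0 x : (0 : M) ^^ x = 0.
Proof. by apply: (addrI (0 ^^ x)); rewrite -gmactD !addr0. Qed.

Lemma gmactN x : {morph @gmact _ M ^~ x : m / - m}.
Proof. by move=> m; apply: (addrI (m ^^ x)); rewrite -gmactD !subrr gmact0. Qed.

Lemma gmactB x : {morph @gmact _ M ^~ x : m n / m - n}.
Proof. by move=> m n; rewrite gmactD gmactN. Qed.

Lemma gmact_sum x I (r : seq I) (P : pred I) (F : I -> M) :
  (\sum_(i <- r | P i) F i) ^^ x = \sum_(i <- r | P i) F i ^^ x.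
Proof. by apply: (big_morph (@gmact _ M ^~ x)); [apply: gmactD | apply: gmact0]. Qed.

Lemma gmactMn x m n : (m *+ n) ^^ x = m ^^ x *+ n.
Proof. by elim: n => [|n IHn]; rewrite ?mulr0n ?gmact0 // !mulrS gmactD IHn. Qed.

(** The operator x - 1 of the group ring. *)
Definition delta x m := m ^^ x - m.

Lemma deltaB x : {morph delta x : m n / m - n}.
Proof. by move=> m n; rewrite /delta gmactB opprD addrACA -opprD. Qed.

Lemma delta0 x : delta x 0 = 0.
Proof. by rewrite /delta gmact0 subrr. Qed.

Lemma deltaN x : {morph delta x : m / - m}.
Proof. by move=> m; rewrite -sub0r deltaB delta0 sub0r. Qed.

Lemma deltaD x : {morph delta x : m n / m + n}.
Proof. by move=> m n; rewrite -[n in LHS]opprK deltaB deltaN opprK. Qed.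

Lemma deltaMn x m n : delta x (m *+ n) = delta x m *+ n.
Proof. by rewrite /delta gmactMn mulrnBl. Qed.

Lemma delta_comm x y m : (x * y = y * x)%g -> delta x (delta y m) = delta y (delta x m).
Proof.
move=> cxy; rewrite /delta !gmactB -!gmactM cxy !opprB addrACA [RHS]addrACA.
by congr (_ + _); apply: addrC.
Qed.

Lemma delta_eq0 x m : (delta x m == 0) = (m ^^ x == m).
Proof. exact: subr_eq0. Qed.

Lemma gmact_delta x m : m ^^ x = m + delta x m.
Proof. by rewrite /delta addrC subrK. Qed.

(** If c generates K modulo a normal subgroup H of index n, this is the trace of
    K / H on the fixed points of H. *)
Definition ptrace c n m := \sum_(i < n) m ^^ (c ^+ i)%g.

Lemma ptraceB c n : {morph ptrace c n : m1 m2 / m1 - m2}.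
Proof.
by move=> m1 m2; rewrite /ptrace -sumrB; apply: eq_bigr => i _; rewrite gmactB.
Qed.

Lemma ptrace_delta c n m : ptrace c n (delta c m) = m ^^ (c ^+ n)%g - m.
Proof.
elim: n => [|n IHn]; first by rewrite /ptrace big_ord0 expg0 gmact1 subrr.
rewrite /ptrace big_ord_recr /= -/(ptrace _ _ _) IHn /delta gmactB -gmactM -expgS.
by rewrite addrC addrA subrK.
Qed.

Lemma delta_ptrace c n m : delta c (ptrace c n m) = m ^^ (c ^+ n)%g - m.
Proof.
rewrite -ptrace_delta /delta /ptrace gmact_sum -sumrB.
by apply: eq_bigr => i _; rewrite gmactB -!gmactM -expgS -expgSr.
Qed.

Definition fixed (A : {set M}) (K : {set qT}) :=
  [set a in A | [forall x in K, a ^^ x == a]].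

Lemma fixedP (A : {set M}) (K : {set qT}) a :
  reflect (a \in A /\ forall x, x \in K -> a ^^ x = a) (a \in fixed A K).
Proof.
rewrite inE; apply: (iffP andP) => [[-> /forall_inP H] | [-> H]]; split=> //.
  by move=> x /H/eqP.
by apply/forall_inP => x /H/eqP.
Qed.

Definition trace (K : {set qT}) m := \sum_(x in K) m ^^ x.

Lemma traceB K : {morph trace K : m n / m - n}.
Proof.
by move=> m n; rewrite /trace -sumrB; apply: eq_bigr => i _; rewrite gmactB.
Qed.

Lemma traceD K : {morph trace K : m n / m + n}.
Proof.
by move=> m n; rewrite /trace -big_split; apply: eq_bigr => i _; rewrite gmactD.
Qed.

Lemma trace0 K : trace K 0 = 0.
Proof. by rewrite /trace big1 // => x _; rewrite gmact0. Qed.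

Lemma trace_gmact (K : {group qT}) x m : x \in K -> trace K m ^^ x = trace K m.
Proof.
move=> Kx; rewrite /trace gmact_sum [RHS](reindex_inj (mulIg x)) /=.
by apply: eq_big => y; rewrite ?groupMr // gmactM.
Qed.

Definition submodule (K : {set qT}) (A : {set M}) :=
  zmod_closed A /\ forall a x, x \in K -> a \in A -> a ^^ x \in A.

(** Vanishing of the zeroth Tate cohomology group; the reverse inclusion holds
    for all submodules ([trace_fixed]). *)
Definition tate0_trivial (K : {set qT}) (A : {set M}) :=
  fixed A K \subset trace K @: A.

End Action.

(** * Trivial cohomology passes to subgroups *)

Section CyclicQuotient.

Variables (qT : finGroupType) (M : gmodule qT) (p : nat).
Implicit Types (A B D : {set M}) (K H : {group qT}) (c x y : qT).

(** Over the cyclic group of order n generated by c, H^0 and H^-1 of a finite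
    module D have the same order: the order of D is the product of those of
    the kernel and of the image both of c - 1 and of the trace, and each image
    lies in the other kernel. *)
Lemma herbrand D c n :
    zmod_closed D -> (forall d, d \in D -> d ^^ c \in D) ->
    (forall d, d \in D -> d ^^ (c ^+ n)%g = d) ->
  ([set d in D | delta c d == 0] \subset ptrace c n @: D) =
  ([set d in D | ptrace c n d == 0] \subset delta c @: D).
Proof.
move=> zD Dc cnD; have [D0 DB] := zD.
have Dcn d i : d \in D -> d ^^ (c ^+ i)%g \in D.
  by move=> Dd; elim: i => [|i IHi]; rewrite ?gmact1 // expgSr gmactM Dc.
have DD : {in D &, forall a b, a + b \in D}.
  by move=> a b; apply: (GRing.zmod_closedD zD).2.
have DNd d : d \in D -> ptrace c n d \in D.
  by move=> Dd; rewrite /ptrace; apply: (big_ind [in D]) => // i _; apply: Dcn.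
have sT : ptrace c n @: D \subset [set d in D | delta c d == 0].
  apply/subsetP => _ /imsetP[d Dd ->].
  by rewrite inE DNd //= delta_ptrace cnD // subrr.
have sX : delta c @: D \subset [set d in D | ptrace c n d == 0].
  apply/subsetP => _ /imsetP[d Dd ->].
  by rewrite inE DB ?Dc //= ptrace_delta cnD // subrr.
have := card_image_kernel zD (in2W (deltaB c)).
rewrite (card_image_kernel zD (in2W (ptraceB c n))).
have F0 : (0 < #|[set d in D | (delta c d == 0)%R]|)%N.
  by apply/card_gt0P; exists 0; rewrite inE D0 delta0 eqxx.
have K0 : (0 < #|[set d in D | (ptrace c n d == 0)%R]|)%N.
  apply/card_gt0P; exists 0; rewrite inE D0 /=.
  by rewrite -[X in ptrace _ _ X](subrr 0) ptraceB subrr.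
move=> eqc; apply/idP/idP => s.
  have/eqP e : ptrace c n @: D == [set d in D | delta c d == 0] by rewrite eqEsubset sT.
  have/eqP -> // : delta c @: D == [set d in D | ptrace c n d == 0].
  rewrite eqEcard sX /=; move: eqc; rewrite e mulnC => /eqP.
  by rewrite eqn_pmul2l // => /eqP ->.
have/eqP e : delta c @: D == [set d in D | ptrace c n d == 0] by rewrite eqEsubset sX.
have/eqP -> // : ptrace c n @: D == [set d in D | delta c d == 0].
rewrite eqEcard sT /=; move: eqc; rewrite e [RHS]mulnC => /eqP.
by rewrite eqn_pmul2l // => /eqP ->.
Qed.

Hypothesis p_pr : prime p.

(** As p is prime, K is the disjoint union of the cosets H c^i for i < p. *)
Lemma trace_split H K c (m : M) :
    (H <| K)%g -> #|K : H|%g = p -> c \in K -> c \notin H ->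
  trace K m = ptrace c p (trace H m).
Proof.
move=> nHK iHK Kc Hc; have sHK := normal_sub nHK.
have Hcp : (c ^+ p)%g \in H by rewrite -iHK expg_index.
pose f (u : qT * 'I_p) := (u.1 * c ^+ u.2)%g.
have cH n : (0 < n < p)%N -> (c ^+ n)%g \notin H.
  case/andP=> n0 np; apply: contra Hc => Hcn.
  have cop : coprime n p by rewrite coprime_sym prime_coprime // gtnNdvd.
  have : (c ^+ (egcdn n p).1 ^+ n)%g \in H by rewrite expgAC groupX.
  rewrite -expgM; case: egcdnP => //= a b; rewrite (eqP cop) => -> _.
  by rewrite mulnC expgD expgM expg1 groupMl // groupX.
have inj : {in setX H [set: 'I_p] &, injective f}.
  have aux h1 h2 (i j : 'I_p) : h1 \in H -> h2 \in H ->
      f (h1, i) = f (h2, j) -> (i <= j)%N -> (h1, i) = (h2, j).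
    rewrite /f /= => H1 H2 e leij.
    have cji : (c ^+ (j - i) = h2^-1 * h1)%g.
      apply: (mulIg (c ^+ i)%g); rewrite -expgD subnK // -mulgA e mulKg //.
    have : (c ^+ (j - i))%g \in H by rewrite cji groupM ?groupV.
    have [lij|leji] := ltnP i j.
      rewrite (negPf (cH _ _)) // subn_gt0 lij /=.
      exact: leq_ltn_trans (leq_subr _ _) (ltn_ord j).
    have eij : i = j by apply/val_inj/eqP; rewrite eqn_leq leij.
    by move=> _; move: e; rewrite eij => /mulIg ->.
  case=> h1 i [h2 j] /setXP[/= H1 _] /setXP[/= H2 _] e.
  by have [lij | /ltnW lij] := leqP i j; [apply: aux | apply/esym/aux].
have -> : (K : {set qT}) = f @: setX H [set: 'I_p].
  apply/esym/eqP; rewrite eqEcard; apply/andP; split.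
    apply/subsetP => _ /imsetP[[h i] /setXP[/= Hh _] ->].
    by rewrite groupM ?groupX // (subsetP sHK).
  by rewrite card_in_imset // cardsX cardsT card_ord -iHK Lagrange.
rewrite /trace big_imset //= /ptrace.
under [RHS]eq_bigr do rewrite gmact_sum.
rewrite exchange_big /= pair_big_dep /=.
by apply: eq_big => [[h i]|[h i] _]; rewrite ?inE /= ?andbT // gmactM.
Qed.

Lemma trace1 (m : M) : trace [1 qT]%g m = m.
Proof. by rewrite /trace big_set1 gmact1. Qed.

(** Modulo p, a set acted on by a p-group has as many fixed points as points; if A
    were not zero, both numbers would be divisible by p. *)
Lemma fixed_nontrivial K A :
    (p.-group K)%g -> (p.-nat #|A|)%N -> submodule K A -> fixed A K \subset [set 0] ->
  A = [set 0].
Proof.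
move=> pK pA [[A0 AB] AK] s.
pose to := @TotalAction _ _ (@gmact _ M) (@gmact1 _ M) (@gmactM _ M).
have acts : [acts K, on A | to]%g.
  apply/subsetP => x Kx; rewrite !inE; apply/subsetP => a Aa.
  by rewrite inE; apply: AK.
have := pgroup_fix_mod pK acts.
have -> : ('Fix_(A | to)(K))%g = [set 0].
  apply/eqP; rewrite eqEsubset; apply/andP; split.
    apply/subsetP => a /setIP[Aa /afixP fa]; apply: (subsetP s).
    by apply/fixedP.
  apply/subsetP => _ /set1P ->; rewrite inE A0; apply/afixP => x _.
  exact: gmact0.
rewrite cards1 => /eqP A1; have : ~~ (p %| #|A|)%N.
  by rewrite /dvdn (eqP A1) modn_small ?prime_gt1.
case/p_natP: pA => [[|k] cA]; rewrite cA; last by rewrite expnS dvdn_mulr.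
by move=> _; apply/esym/eqP; rewrite eqEcard sub1set A0 cards1 cA.
Qed.

(** The iterates of c - 1 on m are eventually periodic. On the elements fixed by
    the r-th power of c - 1, where r is the period, c has no nonzero fixed
    point, so that only 0 is periodic. *)
Lemma delta_nilpotent c (m : M) :
  (p.-nat #|M|)%N -> (p.-elt c)%g -> exists n, iter n (delta c) m = 0.
Proof.
move=> pM pc; have /trajectP[i lti] := looping_order (delta c) m.
set n := fingraph.order _ _ in lti *; rewrite -(subnK (ltnW lti)) iterD.
set u := iter i _ m => eu; exists i; rewrite -/u.
have r_gt0 : (0 < n - i)%N by rewrite subn_gt0.
move: (n - i)%N r_gt0 eu => r r_gt0 eu.
pose g (e : M) := iter r (delta c) e - e.
have iB k : {morph iter k (@delta _ M c) : a b / a - b}.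
  by elim: k => [|k IHk] a b //=; rewrite IHk deltaB.
have i0 k : iter k (delta c) (0 : M) = 0 by elim: k => //= k ->; rewrite delta0.
have gB : {morph g : a b / a - b}.
  by move=> a b; rewrite /g iB [in RHS]opprD [in RHS]addrACA -opprD.
have zT : zmod_closed [set: M] by split=> [|a b _ _]; rewrite inE.
have cE := card_image_kernel zT (in2W gB).
have {}cE : (p.-nat #|[set e in [set: M] | (g e == 0)%R]|)%N.
  move: pM; rewrite -cardsT cE pnatM => /andP[pE _]; exact: pE.
suff E0 : [set e in [set: M] | g e == 0] = [set 0].
  have : u \in [set e in [set: M] | g e == 0] by rewrite !inE /g eu subrr eqxx.
  by rewrite E0 => /set1P.
have dX x (e : M) : x \in <[c]>%g -> iter r (delta c) (e ^^ x) = iter r (delta c) e ^^ x.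
  case/cycleP => k ->; elim: r {r_gt0 eu g gB cE} => //= r ->.
  by rewrite /delta gmactB -!gmactM -expgS -expgSr.
apply: (@fixed_nontrivial <[c]>) => //.
- split; first split=> [|a b]; rewrite ?inE /g.
  + by rewrite i0 subrr eqxx.
  + by move=> /eqP ga /eqP gb; rewrite -/(g _) gB /g ga gb subrr eqxx.
  by move=> a x cx; rewrite !inE /g dX // -gmactB => /eqP ->; rewrite gmact0 eqxx.
apply/subsetP => e /fixedP[]; rewrite !inE /g subr_eq0 => /eqP ge /(_ c).
rewrite cycle_id => /(_ isT)/eqP; rewrite -delta_eq0 => /eqP de.
by rewrite -ge; case: r r_gt0 {eu g gB cE dX ge} => // r _; rewrite iterSr de i0.
Qed.

Lemma fixed_zmod K A : zmod_closed A -> zmod_closed (fixed A K).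
Proof.
move=> [A0 AB]; split=> [|a b /fixedP[Aa fa] /fixedP[Ab fb]]; apply/fixedP.
  by split=> // x _; rewrite gmact0.
by split=> [|x Kx]; rewrite ?AB // gmactB fa ?fb.
Qed.

Lemma fixed_norm H A x a :
  x \in 'N(H)%g -> (a \in A -> a ^^ x \in A) -> a \in fixed A H -> a ^^ x \in fixed A H.
Proof.
move=> Nx Ax /fixedP[Aa fa]; apply/fixedP; split=> [|h Hh]; first exact: Ax.
by rewrite -gmactM conjgCV gmactM fa // memJ_norm ?groupV.
Qed.

Lemma trace_fixed K A a : submodule K A -> a \in A -> trace K a \in fixed A K.
Proof.
move=> [zA AK] Aa; apply/fixedP; split=> [|x Kx]; last exact: trace_gmact.
apply: (big_ind [in A]) => [|u v|x Kx]; last exact: AK.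
  by case: zA.
exact: (GRing.zmod_closedD zA).2.
Qed.

Lemma submoduleS H K A : H \subset K -> submodule K A -> submodule H A.
Proof. by move=> sHK [zA AK]; split=> // a x /(subsetP sHK); apply: AK. Qed.

End CyclicQuotient.

(** A maximal subgroup H of a p-group K is normal of index p, so any c outside H
    generates K modulo H. The choice of c precedes that of the module, because
    [tate0_shift] uses one c for two modules. *)
Lemma maximal_pgroup (qT : finGroupType) (p : nat) (H K : {group qT}) :
    prime p ->
    (p.-group K)%g -> maximal H K ->
  exists c, [/\ c \in K, c \in 'N(H)%g, (c ^+ p)%g \in H,
    forall (M : gmodule qT) (A : {set M}) a, submodule K A -> a \in fixed A H -> a ^^ c = a ->
      a \in fixed A K
    & forall (M : gmodule qT) (a : M), trace K a = ptrace c p (trace H a)].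
Proof.
move=> p_pr pK maxH; have nHK := p_maximal_normal pK maxH.
have iHK := p_maximal_index pK maxH; have sHK := normal_sub nHK.
have /subsetPn[c Kc Hc] := proper_subn (maxgroupp maxH).
have Nc := subsetP (normal_norm nHK) _ Kc.
exists c; split=> // [|M A a [_ AK] /fixedP[Aa fa] fc|M a].
- by rewrite -iHK expg_index.
- apply/fixedP; split=> // x; have : K \subset [set x in K | a ^^ x == a].
    have gS : group_set [set x in K | a ^^ x == a].
      apply/group_setP; split=> [|y z]; first by rewrite inE group1 gmact1 eqxx.
      rewrite !inE => /andP[Ky /eqP fy] /andP[Kz /eqP fz].
      by rewrite groupM // gmactM fy fz eqxx.
    have [_ maxP] := maxgroupP maxH; apply: contraT => nK.
    have := maxP (Group gS); rewrite properE nK andbT /=.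
    rewrite (_ : _ \subset K); last by apply/subsetP => z /setIdP[].
    move=> /(_ isT) e; have : c \in H; last by rewrite (negPf Hc).
    rewrite -e ?inE ?Kc ?fc ?eqxx //.
    by apply/subsetP => h Hh; rewrite inE (subsetP sHK) //= fa.
  by move/subsetP/(_ x) => S /S; rewrite inE => /andP[_ /eqP].
exact: trace_split.
Qed.

Section Restriction.

Variables (qT : finGroupType) (M : gmodule qT) (p : nat).
Implicit Types (A B D : {set M}) (K H : {group qT}).
Hypothesis p_pr : prime p.

(** Let D be the fixed points of H in A and B the traces from H. The hypothesis
    says that all fixed points of c in D are partial traces of elements of B, so
    that H^0 and H^-1 of the cyclic group K / H vanish on B. An element d of D
    with (c - 1) d in B therefore lies in B, and c - 1 is nilpotent on D. *)
Lemma tate0_maximal H K A :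
    (p.-nat #|M|)%N -> (p.-group K)%g -> submodule K A -> maximal H K ->
  tate0_trivial K A -> tate0_trivial H A.
Proof.
move=> pM pK sA maxH tK; have sHK := proper_sub (maxgroupp maxH).
have sAH := submoduleS sHK sA; have [[A0 AB] AK] := sA.
have [c [Kc Nc Hcp fixc trc]] := maximal_pgroup p_pr pK maxH.
set D := fixed A H; set B := trace H @: A.
have zD : zmod_closed D by apply: fixed_zmod.
have sBD : B \subset D by apply/subsetP => _ /imsetP[a Aa ->]; apply: trace_fixed.
have zB : zmod_closed B.
  split=> [|_ _ /imsetP[a Aa ->] /imsetP[b Ab ->]].
    by apply/imsetP; exists 0; rewrite ?trace0.
  by rewrite -traceB imset_f ?AB.
have Dc d : d \in D -> d ^^ c \in D by apply: fixed_norm => //; apply: AK.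
have cpD d : d \in D -> d ^^ (c ^+ p)%g = d by case/fixedP => _ ->.
have Bc d : d \in B -> d ^^ c \in B.
  case/imsetP => a Aa ->; apply/imsetP; exists (a ^^ c); first exact: AK.
  rewrite /trace gmact_sum [RHS](reindex_inj (conjg_inj c)) /=.
  by apply: eq_big => [x|x _]; rewrite ?memJ_norm // -!gmactM conjgC.
(* The fixed points of c in D are traces from H of elements of A, hence partial
   traces of elements of B. *)
have fB : [set d in D | delta c d == 0] \subset ptrace c p @: B.
  apply/subsetP => d /setIdP[Dd]; rewrite delta_eq0 => /eqP fd.
  have /imsetP[a Aa ->] := subsetP tK d (fixc M A d sA Dd fd).
  by rewrite trc !imset_f.
have kB : [set d in B | ptrace c p d == 0] \subset delta c @: B.
  rewrite -herbrand // => [|d /(subsetP sBD)/cpD //].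
  by apply: subset_trans fB; apply/subsetP => d /setIdP[/(subsetP sBD) Dd dd]; apply/setIdP.
(* H^-1 of B vanishes, so d differs from an element of B by a fixed point of c. *)
have step d : d \in D -> delta c d \in B -> d \in B.
  move=> Dd Bd; have : delta c d \in [set d in B | ptrace c p d == 0].
    by rewrite inE Bd ptrace_delta cpD ?subrr /=.
  move/(subsetP kB)/imsetP => [b Bb /eqP]; rewrite -subr_eq0 -deltaB => db0.
  have : d - b \in [set d in D | delta c d == 0].
    by rewrite inE db0 (zD.2 d b) // (subsetP sBD).
  move/(subsetP fB)/imsetP => [b' Bb' e]; rewrite -[d](subrK b) e.
  have [_ BD] := GRing.zmod_closedD zB; apply: (BD) => //.
  have /imsetP[a Aa ->] := Bb'.
  apply: (big_ind [in B]) => [|u v|i _]; [by case: zB | exact: BD | ].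
  by elim: (i : nat) => [|k IHk]; rewrite ?gmact1 ?imset_f // expgSr gmactM Bc.
apply/subsetP => d Dd; have [n] := delta_nilpotent p_pr d pM (mem_p_elt pK Kc).
elim: n d Dd => [|n IHn] d Dd; first by move=> /= ->; case: zB.
by rewrite iterSr => /IHn Bd; apply: step => //; apply: Bd; rewrite (zD.2 _ _ (Dc _ Dd)).
Qed.

Lemma tate0_sub H K A :
    (p.-nat #|M|)%N -> (p.-group K)%g -> submodule K A -> H \subset K ->
  tate0_trivial K A -> tate0_trivial H A.
Proof.
move=> pM; have [n] := ubnP #|K|; elim: n => // n IHn in K *.
rewrite ltnS => leKn pK sA sHK tK; have [-> // | [L maxL sHL]] := maximal_exists sHK.
have ltLK := maxgroupp maxL; have sLK := proper_sub ltLK.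
apply: (IHn L _ (pgroupS sLK pK) (submoduleS sLK sA) sHL).
  exact: leq_trans (proper_card ltLK) leKn.
exact: (tate0_maximal pM pK sA maxL tK).
Qed.

End Restriction.

Lemma submoduleT qT (M : gmodule qT) (K : {set qT}) : submodule K [set: M].
Proof. by split; [split=> [|a b _ _] | move=> a x _ _]; rewrite inE. Qed.

(** * Dimension shifting *)

Section DimensionShift.

Variables (qT : finGroupType) (p : nat).
Hypothesis p_pr : prime p.

Section Morphism.

Variables (C C' : gmodule qT) (d : C -> C').
Hypotheses (dB : {morph d : a b / a - b}) (dJ : forall a x, d (a ^^ x) = d a ^^ x).

Lemma equivariant0 : d 0 = 0.
Proof. by rewrite -[X in d X](subrr 0) dB subrr. Qed.

Lemma equivariantD : {morph d : a b / a + b}.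
Proof.
move=> a b; have dN : d (- b) = - d b by rewrite -sub0r dB equivariant0 sub0r.
by rewrite -[b in LHS]opprK dB dN opprK.
Qed.

Lemma equivariant_trace K a : d (trace K a) = trace K (d a).
Proof.
rewrite /trace (big_morph d equivariantD equivariant0).
by apply: eq_bigr => x _; rewrite dJ.
Qed.

Lemma submodule_ker (K : {set qT}) : submodule K [set a | d a == 0].
Proof.
split; first split=> [|a b]; rewrite ?inE ?equivariant0 ?eqxx //.
  by move=> /eqP da /eqP db; rewrite dB da db subrr.
by move=> a x _; rewrite !inE dJ => /eqP ->; rewrite gmact0.
Qed.

Lemma submodule_image (K : {set qT}) : submodule K (d @: [set: C]).
Proof.
split; first split=> [|_ _ /imsetP[a _ ->] /imsetP[b _ ->]].
- by apply/imsetP; exists 0; rewrite ?equivariant0 ?inE.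
- by rewrite -dB imset_f ?inE.
by move=> _ x _ /imsetP[a _ ->]; rewrite -dJ imset_f ?inE.
Qed.

(** By induction on K, with H maximal in K and c generating K modulo H. It
    suffices that H^-1 of K / H vanishes on the fixed points of H in the kernel.
    A class in it is represented by some e, which is (c - 1) m with m in C fixed
    by H, as H^-1 vanishes for C. Then d m is fixed by K, hence is the image of
    a trace from K in C, and subtracting this trace moves m into the kernel
    without changing (c - 1) m. *)
Lemma tate0_shift (K : {group qT}) :
    (p.-nat #|C|)%N -> (p.-group K)%g ->
    (forall H : {group qT}, H \subset K -> tate0_trivial H [set: C]) ->
    (forall H : {group qT}, H \subset K -> tate0_trivial H (d @: [set: C])) ->
  tate0_trivial K [set a | d a == 0].
Proof.
move=> pC; set Z := [set a | d a == 0].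
have [n] := ubnP #|K|; elim: n => // n IHn in K *; rewrite ltnS => leKn pK tC tI.
have [<- | [H maxH _]] := maximal_exists (sub1G K).
  apply/subsetP => a /fixedP[Za _]; apply/imsetP; exists a => //.
  by rewrite trace1.
have ltHK := maxgroupp maxH; have sHK := proper_sub ltHK.
have {IHn} tH : tate0_trivial H Z.
  apply: IHn (pgroupS sHK pK) _ _; first exact: leq_trans (proper_card ltHK) _.
    by move=> L /subset_trans/(_ sHK); apply: tC.
  by move=> L /subset_trans/(_ sHK); apply: tI.
have [c [Kc Nc Hcp fixc trc]] := maximal_pgroup p_pr pK maxH.
have sZ L : submodule L Z := submodule_ker L.
set D := fixed Z H; set E := fixed [set: C] H.
have zD : zmod_closed D by apply: fixed_zmod; case: (sZ K).
have zE : zmod_closed E by apply: fixed_zmod; case: (submoduleT C K).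
have Ec a : a \in E -> a ^^ c \in E by apply: fixed_norm => //; rewrite !inE.
have Dc a : a \in D -> a ^^ c \in D.
  by apply: fixed_norm => //; apply: (sZ K).2 Kc.
have cpE a : a \in E -> a ^^ (c ^+ p)%g = a by case/fixedP => _ ->.
have cpD a : a \in D -> a ^^ (c ^+ p)%g = a by case/fixedP => _ ->.
have kE : [set a in E | ptrace c p a == 0] \subset delta c @: E.
  rewrite -herbrand //; apply/subsetP => a /setIdP[Ea]; rewrite delta_eq0 => /eqP fa.
  have /imsetP[b _ ->] := subsetP (tC K (subxx _)) a (fixc _ _ a (submoduleT C K) Ea fa).
  by rewrite trc imset_f // trace_fixed ?inE //; apply: submoduleT.
have kD : [set a in D | ptrace c p a == 0] \subset delta c @: D.
  apply/subsetP => e /setIdP[De Ne].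
  have /imsetP[m Em def_e] : e \in delta c @: E.
    apply: (subsetP kE); rewrite inE Ne andbT; case/fixedP: De => _ fe.
    by apply/fixedP; rewrite inE.
  have /imsetP[_ /imsetP[m' _ ->] dm] : d m \in trace K @: (d @: [set: C]).
    apply: (subsetP (tI K (subxx _))); apply: fixc; first exact: submodule_image.
      apply/fixedP; rewrite imset_f ?inE //; split=> // h Hh.
      by rewrite -dJ; case/fixedP: Em => _ ->.
    rewrite -dJ; apply/eqP; rewrite -subr_eq0 -dB -/(delta c m) -def_e.
    by case/fixedP: De; rewrite inE.
  apply/imsetP; exists (m - trace K m'); last first.
    by rewrite deltaB -def_e /delta trace_gmact // subrr subr0.
  apply/fixedP; rewrite inE dB dm equivariant_trace subrr; split=> // h Hh.
  rewrite gmactB trace_gmact ?(subsetP sHK) //.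
  by case/fixedP: Em => _ ->.
apply/subsetP => a /fixedP[Za fa].
have /imsetP[e De ->] : a \in ptrace c p @: D.
  have : a \in [set a in D | delta c a == 0].
    rewrite inE delta_eq0 fa // eqxx andbT; apply/fixedP; split=> // h /(subsetP sHK).
    exact: fa.
  by apply: subsetP; rewrite herbrand.
have /imsetP[z Zz ->] := subsetP tH e De.
by rewrite -trc imset_f.
Qed.

End Morphism.
End DimensionShift.

(** * The resolution by homogeneous cochains *)

Section Coinduced.

Variables (qT : finGroupType) (M : gmodule qT).

Definition coind_act (f : {ffun qT -> M}) (x : qT) : {ffun qT -> M} :=
  [ffun g => f (g * x^-1)%g ^^ x].

Fact coind_act1 f : coind_act f 1%g = f.
Proof. by apply/ffunP => g; rewrite ffunE invg1 mulg1 gmact1. Qed.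

Fact coind_actM f x y : coind_act f (x * y)%g = coind_act (coind_act f x) y.
Proof. by apply/ffunP => g; rewrite !ffunE gmactM invMg mulgA. Qed.

Fact coind_actD x : {morph coind_act^~ x : f1 f2 / f1 + f2}.
Proof. by move=> f1 f2; apply/ffunP => g; rewrite !ffunE gmactD. Qed.

Definition coind : gmodule qT := GModule coind_act1 coind_actM coind_actD.

Lemma coindE (f : coind) x g : (f ^^ x) g = f (g * x^-1)%g ^^ x.
Proof. by rewrite ffunE. Qed.

Lemma coindB (f1 f2 : coind) g : (f1 - f2) g = f1 g - f2 g.
Proof. by rewrite !ffunE. Qed.

Lemma coindD (f1 f2 : coind) g : (f1 + f2) g = f1 g + f2 g.
Proof. by rewrite ffunE. Qed.

(** A function fixed by K is the trace of its restriction, extended by zero, to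
    a transversal of the left cosets of K. *)
Lemma tate0_coind (K : {group qT}) : tate0_trivial K [set: coind].
Proof.
apply/subsetP => f /fixedP[_ fK].
pose f' : coind := [ffun g => if repr (g *: K)%g == g then f g else 0].
apply/imsetP; exists f'; rewrite ?inE //; apply/ffunP => g.
rewrite /trace sum_ffunE.
have [k Kk def_r] : exists2 k, k \in K & repr (g *: K)%g = (g * k)%g.
  by apply/lcosetP; apply: mem_repr (lcoset_refl K g).
have reprE x : x \in K -> repr ((g * x^-1) *: K)%g = (g * k)%g.
  move=> Kx; rewrite -def_r; congr repr; apply/lcoset_eqP.
  by rewrite mem_lcoset mulKg groupV.
rewrite (bigD1 k^-1%g) ?groupV //= coindE ffunE reprE ?groupV // invgK eqxx.
rewrite big1 => [|x /andP[Kx neq_x]]; rewrite ?addr0.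
  have := fK k^-1%g; rewrite groupV => /(_ Kk) {1}<-.
  by rewrite coindE invgK.
rewrite coindE ffunE reprE // (inj_eq (mulgI g)) -[k]invgK (inj_eq invg_inj).
by rewrite eq_sym (negPf neq_x) gmact0.
Qed.

End Coinduced.

Section Resolution.

Variables (qT : finGroupType) (M : gmodule qT).

(** Functions of n variables in curried form, so that homogeneous n-cochains are
    the elements of [hcochain n.+1], and [hcochain 0] is M itself. *)
Definition hcochain n : gmodule qT := iter n (@coind qT) M.

(** The alternating sum over the omitted argument ([heval_hdiff]): omitting the
    first argument g leaves f, and the remaining terms make up, with the
    opposite sign, the differential of the function that f becomes once its
    first argument is g. In degree 0 this is the augmentation. *)
Fixpoint hdiff n : hcochain n -> hcochain n.+1 :=
  if n is n'.+1 then fun f => [ffun g => f - hdiff (f g)]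
  else fun m => [ffun=> m].
Arguments hdiff {n} _.

Lemma hdiff0E (m : hcochain 0) g : hdiff m g = m.
Proof. by rewrite ffunE. Qed.

Lemma hdiffSE n (f : hcochain n.+1) g : hdiff f g = f - hdiff (f g).
Proof. by rewrite ffunE. Qed.

Lemma hdiffB n : {morph @hdiff n : a b / a - b}.
Proof.
elim: n => [|n IHn] a b; apply/ffunP => g; rewrite coindB ?hdiff0E // !hdiffSE.
by rewrite coindB IHn opprD addrACA -opprD.
Qed.

Lemma hdiffJ n (f : hcochain n) x : hdiff (f ^^ x) = hdiff f ^^ x.
Proof.
elim: n => [|n IHn] in f *; apply/ffunP => g; rewrite coindE ?hdiff0E // !hdiffSE.
by rewrite coindE gmactB -IHn.
Qed.

Lemma hdiff_hdiff n (f : hcochain n) : hdiff (hdiff f) = 0.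
Proof.
elim: n => [|n IHn] in f *; apply/ffunP => g.
  by rewrite (hdiffSE (hdiff f)) hdiff0E subrr ffunE.
rewrite (hdiffSE (hdiff f)) [RHS]ffunE.
by rewrite hdiffSE hdiffB IHn subr0 subrr.
Qed.

(** Evaluation of the first argument at 1 is a contracting homotopy. *)
Lemma ker_hdiff n : [set f | hdiff f == 0] = @hdiff n @: [set: _].
Proof.
apply/setP => f; rewrite inE; apply/eqP/imsetP => [df | [f' _ ->]]; last exact: hdiff_hdiff.
exists (f 1%g); rewrite ?inE //; apply/eqP; rewrite -subr_eq0 -hdiffSE df.
by rewrite ffunE.
Qed.

Lemma tate0_hcochain n (K : {group qT}) : tate0_trivial K [set: hcochain n.+1].
Proof. exact: tate0_coind. Qed.

Lemma pnat_hcochain p n : (p.-nat #|M| -> p.-nat #|hcochain n|)%N.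
Proof. by move=> pM; elim: n => //= n IHn; rewrite card_ffun pnatX IHn. Qed.

(** The image of the n-th differential is the kernel of the next one, so
    dimension shifting leads from degree n down to the image of the
    augmentation, which is a copy of M. *)
Lemma tate0_of_hdiff p n (K : {group qT}) : prime p ->
    (p.-nat #|M|)%N -> (p.-group [set: qT])%g ->
    tate0_trivial [set: qT] (@hdiff n @: [set: _]) ->
  tate0_trivial K [set: M].
Proof.
move=> p_pr pM pQ t; have pC i := pnat_hcochain i pM.
have {}t (H : {group qT}) : tate0_trivial H (@hdiff n @: [set: _]).
  apply: (tate0_sub p_pr (pC n.+1) pQ _ (subsetT H) t).
  exact: submodule_image (@hdiffB n) (@hdiffJ n) _.
elim: n => [|n IHn] in K t *; last first.
  apply: IHn => H; rewrite -ker_hdiff.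
  apply: (tate0_shift p_pr (@hdiffB _) (@hdiffJ _)) => // [|L _].
    exact: pgroupS (subsetT H) pQ.
  exact: tate0_hcochain.
apply/subsetP => m /fixedP[_ fm].
have /(subsetP (t K))/imsetP[_ /imsetP[m' _ ->]] :
    hdiff (m : hcochain 0) \in fixed (@hdiff 0 @: [set: _]) K.
  by apply/fixedP; rewrite imset_f ?inE //; split=> // x Kx; rewrite -hdiffJ /= fm.
rewrite -equivariant_trace; [|exact: hdiffB|exact: hdiffJ].
move/ffunP/(_ 1%g); rewrite !hdiff0E => ->.
by rewrite imset_f ?inE.
Qed.

End Resolution.

(** * Homogeneous and inhomogeneous cochains *)

Section AbelianType.

Variables (gT : finGroupType) (A : {group gT}).

(** The proof of commutativity is a parameter of the type, so that the additive
    structure can be attached to it. *)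
Definition abelian_type (cAA : abelian A) : Type := subg_of A.

Variable cAA : abelian A.

HB.instance Definition _ := Finite.on (abelian_type cAA).

Let add (a b : abelian_type cAA) : abelian_type cAA := (a * b)%g.
Let opp (a : abelian_type cAA) : abelian_type cAA := (a^-1)%g.
Let zero : abelian_type cAA := 1%g.

Fact abelian_addA : associative add. Proof. exact: mulgA. Qed.
Fact abelian_addC : commutative add.
Proof.
by move=> a b; apply/val_inj/(centsP cAA); apply: subgP.
Qed.
Fact abelian_add0 : left_id zero add. Proof. exact: mul1g. Qed.
Fact abelian_addN : left_inverse zero opp add. Proof. exact: mulVg. Qed.

HB.instance Definition _ := GRing.isZmodule.Build (abelian_type cAA)
  abelian_addA abelian_addC abelian_add0 abelian_addN.

Definition abelian_zmod : finZmodType := abelian_type cAA.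

End AbelianType.

Section HomogeneousCochains.

Variables (qT : finGroupType) (M : gmodule qT).

(** Arguments are passed as infinite sequences, of which the first n entries
    matter ([eq_heval]): the faces of a simplex are then compositions with
    functions from nat to nat. *)
Fixpoint heval n : hcochain M n -> (nat -> qT) -> M :=
  if n is n'.+1 then fun f g => heval (f (g 0%N)) (g \o succn)
  else fun m _ => m.
Arguments heval {n} _ _.

Fixpoint hbuild n (phi : (nat -> qT) -> M) : hcochain M n :=
  if n is n'.+1 then
    [ffun x => hbuild n' (fun g => phi (fun k => if k is k'.+1 then g k' else x))]
  else phi (fun=> 1%g).

Lemma hevalSE n (f : hcochain M n.+1) g :
  heval f g = heval (f (g 0%N)) (g \o succn).
Proof. by []. Qed.

Lemma heval_inj n (f1 f2 : hcochain M n) :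
  (forall g, heval f1 g = heval f2 g) -> f1 = f2.
Proof.
elim: n => [|n IHn] in f1 f2 *; first by move/(_ (fun=> 1%g)).
move=> e; apply/ffunP => x; apply: IHn => g.
exact: (e (fun k => if k is k'.+1 then g k' else x)).
Qed.

Lemma eq_heval n (f : hcochain M n) g1 g2 :
  (forall k, (k < n)%N -> g1 k = g2 k) -> heval f g1 = heval f g2.
Proof.
elim: n => [|n IHn] //= in f g1 g2 * => e; rewrite e //.
by apply: IHn => k ltkn; apply: e.
Qed.

Lemma heval_hbuild n phi g :
    (forall g1 g2, (forall k, (k < n)%N -> g1 k = g2 k) -> phi g1 = phi g2) ->
  heval (hbuild n phi) g = phi g.
Proof.
elim: n => [|n IHn] /= in phi g * => e; first exact: e.
rewrite ffunE IHn => [|g1 g2 e12]; first by apply: e => -[].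
by apply: e => -[|k] // /e12.
Qed.

Lemma hevalB n (f1 f2 : hcochain M n) g : heval (f1 - f2) g = heval f1 g - heval f2 g.
Proof. by elim: n => [|n IHn] //= in f1 f2 g *; rewrite coindB IHn. Qed.

Lemma hevalD n (f1 f2 : hcochain M n) g : heval (f1 + f2) g = heval f1 g + heval f2 g.
Proof. by elim: n => [|n IHn] //= in f1 f2 g *; rewrite coindD IHn. Qed.

Lemma heval0 n g : heval (0 : hcochain M n) g = 0.
Proof. by rewrite -[X in heval X](subrr 0) hevalB subrr. Qed.

Lemma heval_act n (f : hcochain M n) x g :
  heval (f ^^ x) g = heval f (fun k => g k * x^-1)%g ^^ x.
Proof. by elim: n => [|n IHn] //= in f g *; rewrite coindE IHn. Qed.

Definition signed (i : nat) (m : M) := if odd i then - m else m.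

Lemma heval_hdiff n (f : hcochain M n) g :
  heval (hdiff f) g = \sum_(i < n.+1) signed i (heval f (g \o bump i)).
Proof.
elim: n => [|n IHn] in f g *.
  by rewrite big_ord_recl big_ord0 addr0 /= ffunE.
rewrite big_ord_recl hevalSE hdiffSE hevalB IHn; congr (_ + _).
rewrite -sumrN; apply: eq_bigr => i _.
have -> : heval (f (g 0%N)) ((g \o succn) \o bump i) =
          heval (f ((g \o bump (lift ord0 i)) 0%N)) ((g \o bump (lift ord0 i)) \o succn).
  by apply: eq_heval => k _ /=; rewrite /bump addnS.
by rewrite /signed /=; case: (odd i); rewrite /= ?opprK.
Qed.

End HomogeneousCochains.
Arguments heval {qT M n} _ _.

Section TateVanishing.

Variables (aT rT : finGroupType) (D : {group aT}) (R : {group rT}).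
Variable to : groupAction D R.
Variables (Q : {group aT}) (A : {group rT}).
Hypotheses (sQD : Q \subset D) (sAR : A \subset R) (cAA : abelian A).
Hypothesis actA : {acts Q, on A | to}.

Let qT : finGroupType := subg_of Q.
Let M0 := abelian_zmod cAA.
Let val_M (m : M0) : rT := sgval (m : subg_of A).
Let M_of (a : rT) : M0 := subg A a.

Fact val_M_in m : val_M m \in A. Proof. exact: subgP. Qed.
Fact M_ofK a : a \in A -> val_M (M_of a) = a. Proof. exact: subgK. Qed.
Fact val_MK : cancel val_M M_of. Proof. exact: sgvalK. Qed.
Fact M_ofM a b : a \in A -> b \in A -> M_of (a * b)%g = M_of a + M_of b.
Proof. exact: subgM. Qed.

Fact to_in a x : x \in Q -> a \in A -> to a x \in A.
Proof. by move=> Qx; rewrite actA. Qed.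

Fact val_Q (x : qT) : sgval x \in Q. Proof. exact: subgP. Qed.

Definition act_M (m : M0) (x : qT) : M0 := M_of (to (val_M m) (sgval x)).

Fact act_M1 m : act_M m 1%g = m.
Proof. by rewrite /act_M act1 val_MK. Qed.

Fact act_MM m x y : act_M m (x * y)%g = act_M (act_M m x) y.
Proof.
rewrite /act_M M_ofK ?to_in ?val_M_in ?val_Q //.
by rewrite actMin // (subsetP sQD) ?val_Q.
Qed.

Fact act_MD x : {morph act_M^~ x : m n / m + n}.
Proof.
move=> m n; rewrite /act_M -M_ofM ?to_in ?val_M_in ?val_Q //.
by rewrite -gactM ?(subsetP sQD) ?(subsetP sAR) ?val_M_in ?val_Q.
Qed.

Definition gmodule_of_action : gmodule qT := GModule act_M1 act_MM act_MD.
Let M := gmodule_of_action.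

Definition inQ (x : aT) : qT := subg Q x.

Lemma val_M_sum I (r : seq I) (P : pred I) (F : I -> M) :
  val_M (\sum_(i <- r | P i) F i) = (\prod_(i <- r | P i) val_M (F i))%g.
Proof. exact: (big_morph val_M (fun _ _ => erefl) erefl). Qed.

Lemma M_of_prod I (r : seq I) (P : pred I) (F : I -> rT) :
    (forall i, P i -> F i \in A) ->
  M_of (\prod_(i <- r | P i) F i)%g = \sum_(i <- r | P i) M_of (F i).
Proof.
move=> AF; apply: (canLR val_MK); rewrite val_M_sum.
by apply: eq_bigr => i /AF Fi; rewrite M_ofK.
Qed.

Lemma trace_of a : a \in A ->
  trace [set: qT] (M_of a : M) = M_of (\prod_(x in Q) to a x)%g.
Proof.
move=> Aa; rewrite M_of_prod => [|x Qx]; last exact: to_in.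
rewrite [RHS](reindex_onto (fun x : qT => sgval x) inQ) => [|x Qx]; last exact: subgK.
apply: eq_big => [x|x _]; first by rewrite !inE val_Q /inQ sgvalK eqxx.
by rewrite /gmact /= /act_M M_ofK.
Qed.

Local Notation cochain n := {dffun forall _ : n.-tuple aT, rT}.

Lemma cochainsP n (f : cochain n) :
  reflect ((forall t : n.-tuple aT, all [in Q] t -> f t \in A) /\
           forall t : n.-tuple aT, ~~ all [in Q] t -> f t = 1%g)
          (f \in cochains Q A n).
Proof.
apply: (iffP setXnP) => [Af | [Af f1] t].
  by split=> t Qt; have := Af t; rewrite ?Qt // (negPf Qt) => /set1P.
by case: ifPn => [/Af // | /f1 ->]; rewrite inE.
Qed.

Lemma cochain_in n (f : cochain n) t : f \in cochains Q A n -> f t \in A.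
Proof.
by move=> /cochainsP[Af f1]; case: (boolP (all [in Q] t)) => [/Af // | /f1 ->].
Qed.

Lemma alternate_in i a : a \in A -> alternate i a \in A.
Proof. by rewrite /alternate; case: ifP => // _; rewrite groupV. Qed.

Lemma differential_in n (f : cochain n) :
  f \in cochains Q A n -> differential to Q f \in cochains Q A n.+1.
Proof.
move=> Af; apply/cochainsP; split=> [t Qt | t Qt]; rewrite ffunE ?(negPf Qt) // Qt.
rewrite groupM ?alternate_in ?to_in ?cochain_in ?(all_tnthP Qt) //.
by apply: group_prod => i _; rewrite alternate_in ?cochain_in.
Qed.

(** An equivariant homogeneous cochain F and an inhomogeneous cochain f determine
    each other by
      F(g_0, ..., g_n) = f(g_0 g_1^-1, ..., g_(n-1) g_n^-1)^(g_n),
      f(x_1, ..., x_n) = F(x_1 ... x_n, x_2 ... x_n, ..., x_n, 1). *)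
Definition quotients n (g : nat -> qT) : n.-tuple aT :=
  [tuple sgval (g j * (g j.+1)^-1)%g | j < n].

Lemma quotients_in n g : all [in Q] (quotients n g).
Proof. by apply/all_tnthP => j; rewrite tnth_mktuple val_Q. Qed.

Definition homogenize n (f : cochain n) : hcochain M n.+1 :=
  @hbuild _ M n.+1 (fun g => (M_of (f (quotients n g)) : M) ^^ g n).

Lemma heval_homogenize n (f : cochain n) g :
  heval (homogenize f) g = (M_of (f (quotients n g)) : M) ^^ g n.
Proof.
apply: heval_hbuild => g1 g2 e; rewrite e //.
have -> // : quotients n g1 = quotients n g2; apply: eq_from_tnth => j.
by rewrite !tnth_mktuple (e j) ?(e j.+1) ?ltnS ?ltn_ord // ltnW ?ltn_ord.
Qed.

Definition suffixes n (t : n.-tuple aT) (k : nat) : qT :=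
  inQ (\prod_(x <- drop k t) x)%g.

Lemma val_suffixes n (t : n.-tuple aT) k :
  all [in Q] t -> sgval (suffixes t k) = (\prod_(x <- drop k t) x)%g.
Proof.
move=> Qt; rewrite subgK // big_seq group_prod // => x /mem_drop.
exact: (allP Qt).
Qed.

Lemma quotients_suffixes n (t : n.-tuple aT) :
  all [in Q] t -> quotients n (suffixes t) = t.
Proof.
move=> Qt; apply: eq_from_tnth => j; rewrite tnth_mktuple /=.
rewrite !val_suffixes // (drop_nth 1%g) ?size_tuple // big_cons mulgK.
by rewrite (tnth_nth 1%g).
Qed.

Lemma suffixes_last n (t : n.-tuple aT) : suffixes t n = 1%g.
Proof.
by rewrite /suffixes drop_oversize ?size_tuple // big_nil; apply: val_inj; rewrite /= subgK.
Qed.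

Lemma homogenize_suffixes n (f : cochain n) (t : n.-tuple aT) : all [in Q] t ->
  heval (homogenize f) (suffixes t) = M_of (f t).
Proof. by move=> Qt; rewrite heval_homogenize suffixes_last gmact1 quotients_suffixes. Qed.

Lemma homogenize_inj n : {in cochains Q A n &, injective (@homogenize n)}.
Proof.
move=> f1 f2 Af1 Af2 e; apply/ffunP => t; have [Qt|Qt] := boolP (all [in Q] t).
  apply: (can_in_inj M_ofK); rewrite ?cochain_in //.
  by rewrite -!homogenize_suffixes // e.
by have [/cochainsP[_ ->] // /cochainsP[_ ->]] := (Af1, Af2).
Qed.

Lemma homogenizeM n : {in cochains Q A n &, forall f1 f2,
  homogenize (f1 * f2)%g = homogenize f1 + homogenize f2}.
Proof.
move=> f1 f2 Af1 Af2; apply: heval_inj => g.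
rewrite hevalD !heval_homogenize -gmactD; congr (_ ^^ _).
by rewrite -M_ofM ?cochain_in // ffunE.
Qed.

Lemma suffixes_quotients n g k : (k <= n)%N ->
  suffixes (quotients n g) k = (g k * (g n)^-1)%g.
Proof.
move=> lekn; apply: val_inj => /=; rewrite -(subKn lekn).
elim: (n - k)%N (leq_subr k n) => [|j IHj] ltjn.
  by rewrite subn0 suffixes_last mulgV.
have ltn : (n - j.+1 < n)%N by rewrite ltn_subrL; case: (n) ltjn.
have Sn : (n - j.+1).+1 = (n - j)%N by rewrite subnSK.
rewrite val_suffixes ?quotients_in // (drop_nth 1%g) ?size_tuple // big_cons Sn.
rewrite -(tnth_nth 1%g _ (Ordinal ltn)) tnth_mktuple -val_suffixes ?quotients_in //.
by rewrite IHj ?(ltnW ltjn) //= Sn mulgA mulgKV.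
Qed.

(** Multiplying two consecutive quotients, or dropping the first or the last
    one, amounts to omitting one of the arguments g_i. *)
Lemma face_quotients n g (i : 'I_n.+2) :
  face i (quotients n.+1 g) = quotients n (g \o bump i).
Proof.
apply: eq_from_tnth => j; rewrite !tnth_mktuple /= /bump /= !add1n.
have [lt_ji|lt_ij|eq_ji] := ltngtP j.+1 i.
- by rewrite leqNgt (ltnW lt_ji).
- by rewrite -ltnS lt_ij.
by rewrite -eq_ji ltnn mulgA mulgKV.
Qed.

Lemma M_of_alternate i a : a \in A -> M_of (alternate i a) = signed i (M_of a : M).
Proof.
move=> Aa; rewrite /alternate /signed; case: ifP => // _.
by apply: val_inj; rewrite /= !subgK ?groupV.
Qed.

Lemma signed_act i (m : M) x : signed i m ^^ x = signed i (m ^^ x).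
Proof. by rewrite /signed; case: ifP => // _; rewrite gmactN. Qed.

Lemma hdiff_homogenize n (f : cochain n) : f \in cochains Q A n ->
  hdiff (homogenize f) = homogenize (differential to Q f).
Proof.
move=> Af; apply: heval_inj => g; rewrite heval_hdiff heval_homogenize ffunE quotients_in.
have AFi (i : 'I_n.+1) :
    alternate i (f (face (widen_ord (leqnSn n.+1) i) (quotients n.+1 g))) \in A.
  by rewrite alternate_in ?cochain_in.
have Al : to (f (face ord_max (quotients n.+1 g))) (tnth (quotients n.+1 g) ord_max) \in A.
  by rewrite to_in ?cochain_in ?(all_tnthP (quotients_in _ _)).
rewrite M_ofM ?alternate_in ?group_prod // M_of_prod // gmactD gmact_sum.
rewrite [LHS]big_ord_recr; congr (_ + _).
  apply: eq_bigr => i _; rewrite M_of_alternate ?cochain_in // signed_act.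
  rewrite face_quotients heval_homogenize /=.
  by have -> : bump i n = n.+1 by rewrite /bump -ltnS ltn_ord.
rewrite M_of_alternate // signed_act heval_homogenize face_quotients.
congr (signed _ _); rewrite /= /bump ltnn add0n.
(* The twist of the last face makes up for the change of last argument. *)
have -> : g n = (g n * (g n.+1)^-1 * g n.+1)%g by rewrite mulgKV.
rewrite act_MM tnth_mktuple; congr act_M.
by rewrite /act_M M_ofK ?cochain_in.
Qed.

Lemma homogenize_fixed n (f : cochain n) :
  homogenize f \in fixed [set: hcochain M n.+1] [set: qT].
Proof.
apply/fixedP; rewrite inE; split=> // x _; apply: heval_inj => g.
rewrite heval_act !heval_homogenize -gmactM mulgKV.
suff -> : quotients n (fun k => g k * x^-1)%g = quotients n g by [].
by apply: eq_from_tnth => j; rewrite !tnth_mktuple invMg invgK mulgA mulgKV.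
Qed.

Lemma fixed_homogenize n (F : hcochain M n.+1) :
    F \in fixed [set: _] [set: qT] ->
  exists2 f : cochain n, f \in cochains Q A n & homogenize f = F.
Proof.
move=> /fixedP[_ fF].
pose f : cochain n :=
  [ffun t : n.-tuple aT => if all [in Q] t then val_M (heval F (suffixes t)) else 1%g].
exists f.
  apply/cochainsP; split=> [t Qt|t Qt]; rewrite ffunE ?Qt ?val_M_in //.
  by rewrite (negPf Qt).
apply: heval_inj => g; rewrite heval_homogenize ffunE quotients_in val_MK.
rewrite -[in RHS](fF (g n)) ?inE // heval_act; congr (_ ^^ _).
by apply: eq_heval => k ltkn; apply: suffixes_quotients.
Qed.

Lemma quotient1_sub (gT : finGroupType) (H : {set gT}) (K L : {group gT}) :
  abelian L -> H \subset L -> K \subset L -> (H / K = 1)%g -> H \subset K.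
Proof.
move=> cLL sHL sKL HK1; rewrite -quotient_sub1 ?HK1 //.
apply: subset_trans (cent_sub K); apply: subset_trans (centS sKL).
exact: subset_trans sHL cLL.
Qed.

Lemma trace_imageP b :
  reflect (exists m : M, b = val_M (trace [set: qT] m)) (b \in trace_image to Q A).
Proof.
apply: (iffP imsetP) => [[a Aa ->] | [m ->]].
  exists (M_of a : M); rewrite trace_of // M_ofK // group_prod // => x Qx.
  exact: to_in.
exists (val_M m); rewrite ?val_M_in // -[m in trace _ m]val_MK trace_of ?val_M_in //.
by rewrite M_ofK // group_prod // => x Qx; rewrite to_in ?val_M_in.
Qed.

Lemma trace_image_group : group_set (trace_image to Q A).
Proof.
apply/group_setP; split=> [|_ _ /trace_imageP[m1 ->] /trace_imageP[m2 ->]].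
  by apply/trace_imageP; exists 0; rewrite trace0.
by apply/trace_imageP; exists (m1 + m2); rewrite traceD.
Qed.

Lemma cochains_abelian n : abelian (cochains Q A n).
Proof.
apply/centsP => f1 Af1 f2 Af2; apply/ffunP => t; rewrite !ffunE.
by apply: (centsP cAA); rewrite cochain_in.
Qed.

Lemma differentialM n : {in cochains Q A n &, {morph differential to Q (n := n) :
  f1 f2 / (f1 * f2)%g}}.
Proof.
move=> f1 f2 Af1 Af2; apply: homogenize_inj; rewrite ?groupM ?differential_in ?groupM //.
rewrite homogenizeM ?differential_in // -!hdiff_homogenize ?groupM //.
by rewrite homogenizeM // (equivariantD (@hdiffB _ M _)).
Qed.

Lemma homogenize1 n : homogenize (1%g : cochain n) = 0.
Proof.
apply: heval_inj => g; rewrite heval_homogenize heval0 ffunE.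
have -> : M_of 1%g = 0 by apply: val_inj; rewrite /= subgK.
exact: gmact0.
Qed.

Lemma coboundaries_group n : group_set (coboundaries to Q A n).
Proof.
apply/group_setP; split=> [|_ _ /imsetP[f1 Af1 ->] /imsetP[f2 Af2 ->]].
  apply/imsetP; exists 1%g => //; apply: homogenize_inj; rewrite ?differential_in //.
  rewrite -hdiff_homogenize // homogenize1.
  by rewrite homogenize1 (equivariant0 (@hdiffB _ M _)).
by apply/imsetP; exists (f1 * f2)%g; rewrite ?groupM // differentialM.
Qed.

(** Fixed elements of the image of the differential are homogenized cocycles,
    hence by assumption homogenized coboundaries, that is differentials of fixed
    homogeneous cochains. These are traces, because homogeneous cochains are
    coinduced, and the differential commutes with traces. In degree 0 the
    image is a copy of the module. *)
Lemma tate0_of_tate_cohomology n : tate_cohomology to Q A n = 1%g ->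
  tate0_trivial [set: qT] (@hdiff _ M n @: [set: hcochain M n]).
Proof.
case: n => [|n] H1; apply/subsetP => F /fixedP[/imsetP[m _ def_F] fF].
  have /(_ _ _ _ H1) := @quotient1_sub _ _ (Group trace_image_group) A cAA.
  have -> : ('Fix_(A | to)(Q))%g \subset A by apply: subsetIl.
  have -> : Group trace_image_group \subset A.
    by apply/subsetP => _ /trace_imageP[m' ->]; apply: val_M_in.
  move/(_ isT isT)/subsetP/(_ (val_M m)) => S.
  have {}/S/trace_imageP[m' /(can_inj val_MK) def_m] : val_M m \in ('Fix_(A | to)(Q))%g.
    rewrite inE val_M_in; apply/afixP => x Qx.
    have := fF (inQ x); rewrite inE def_F -(@hdiffJ _ M 0 m) => /(_ isT)/ffunP/(_ 1%g).
    rewrite !hdiff0E => /(congr1 val_M).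
    by rewrite /gmact /= /act_M subgK // M_ofK // to_in // val_M_in.
  rewrite def_F def_m (equivariant_trace (@hdiffB _ M _) (@hdiffJ _ M _)).
  by rewrite !imset_f ?inE.
have [|f Af def_f] := @fixed_homogenize n.+1 F; first by apply/fixedP; rewrite inE.
have Zf : f \in cocycles to Q A n.+1.
  rewrite inE Af; apply/eqP; apply: homogenize_inj; rewrite ?differential_in //.
  by rewrite -hdiff_homogenize // def_f def_F homogenize1 hdiff_hdiff.
have /(_ _ _ _ H1) := @quotient1_sub _ _ (Group (coboundaries_group n)) _
  (cochains_abelian n.+1).
have -> : cocycles to Q A n.+1 \subset cochains Q A n.+1.
  by apply/subsetP => f' /setIdP[].
have -> : Group (coboundaries_group n) \subset cochains Q A n.+1.
  by apply/subsetP => _ /imsetP[h Ah ->]; apply: differential_in.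
move/(_ isT isT)/subsetP/(_ f Zf)/imsetP => [h Ah def_h].
have /imsetP[h' _ def_h'] := subsetP (tate0_hcochain M n [set: qT]%G) _ (homogenize_fixed h).
rewrite -def_f def_h -hdiff_homogenize // def_h'.
rewrite (equivariant_trace (@hdiffB _ M _) (@hdiffJ _ M _)).
by rewrite !imset_f ?inE.
Qed.

End TateVanishing.

(** * Modules over noncyclic p-groups *)

Section RankTwo.

Variables (qT : finGroupType) (M : gmodule qT) (p : nat).
Hypotheses (p_pr : prime p) (pM : (p.-nat #|M|)%N).
Implicit Types (m : M) (x y z : qT) (E : {group qT}).

Lemma p_power_torsion m : exists k, m *+ p ^ k = 0.
Proof.
have [k cM] := p_natP pM; exists k; rewrite -cM -FinRing.zmodXgE -cardsT.
by apply: expg_cardG (in_setT _).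
Qed.

Lemma torsion_free_zero : (forall m, m *+ p = 0 -> m = 0) -> forall m, m = 0.
Proof.
move=> inj m; have [k] := p_power_torsion m.
by elim: k => [|k IHk]; rewrite ?mulr1n // expnSr mulrnA => /inj.
Qed.

Lemma divisible_zero (A : {set M}) :
  {in A, forall m, exists2 m', m' \in A & m = m' *+ p} -> {in A, forall m, m = 0}.
Proof.
move=> div; have {}div k : {in A, forall m, exists2 m', m' \in A & m = m' *+ p ^ k}.
  elim: k => [|k IHk] m Am; first by exists m.
  have [m1 /IHk[m2 Am2 ->] ->] := div m Am.
  by exists m2; rewrite // -mulrnA -expnSr.
have [k cM] := p_natP pM; move=> m /(div k)[m' _ ->].
rewrite -cM -FinRing.zmodXgE -cardsT.
by apply: expg_cardG (in_setT _).
Qed.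

Lemma trace_cycle x m : #[x]%g = p -> trace <[x]>%g m = ptrace x p m.
Proof.
move=> ox; rewrite (trace_split p_pr (H := 1%G) (c := x)) ?trace1 ?normal1 ?cycle_id //.
  by rewrite indexg1.
by apply/set1P => x1; move: p_pr; rewrite -ox x1 order1.
Qed.

Lemma fixed_cycle x m : m ^^ x = m -> m \in fixed [set: M] <[x]>%g.
Proof.
move=> fm; apply/fixedP; split=> [|_ /cycleP[i ->]]; first by rewrite inE.
by elim: i => [|i IHi]; rewrite ?gmact1 // expgSr gmactM IHi.
Qed.

(** The trace of a trivial action is multiplication by p. *)
Lemma trivial_action_zero z : #[z]%g = p -> (forall m, m ^^ z = m) ->
  tate0_trivial <[z]>%g [set: M] -> forall m, m = 0.
Proof.
move=> oz triv t m; apply: (@divisible_zero [set: M]); rewrite ?inE // => {}m _.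
have /imsetP[m' _ ->] := subsetP t _ (fixed_cycle (triv m)).
exists m'; rewrite ?inE // trace_cycle // /ptrace.
rewrite (eq_bigr (fun=> m')) => [|i _]; first by rewrite sumr_const card_ord.
by elim: (i : nat) => [|k IHk]; rewrite ?gmact1 // expgSr gmactM IHk.
Qed.

Lemma abelem2_generators E : (p.-abelem E)%g -> #|E| = (p ^ 2)%N ->
  exists x y, [/\ #[x]%g = p, <[x]>%g \subset E, y \in E, (x * y = y * x)%g
      & (y ^+ p = 1)%g]
   /\ [/\ forall m, m ^^ x = m -> m ^^ y = m -> m \in fixed [set: M] E
      & forall m, trace E m = ptrace y p (ptrace x p m)].
Proof.
move=> abE oE; have [pE cEE] := (abelem_pgroup abE, abelem_abelian abE).
have [E1 | [H maxH _]] := maximal_exists (sub1G E).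
  by have := ltn_exp2l 0 2 (prime_gt1 p_pr); rewrite -oE -E1 cards1.
have sHE := proper_sub (maxgroupp maxH).
have oH : #|H| = p.
  apply/eqP; rewrite -(eqn_pmul2r (prime_gt0 p_pr)) -{1}(p_maximal_index pE maxH).
  by rewrite Lagrange // oE.
have /cyclicP[x defH] : cyclic H by rewrite prime_cyclic ?oH.
have ox : #[x]%g = p by rewrite /order -defH.
have [y [Ey _ _ fixy try]] := maximal_pgroup p_pr pE maxH.
have Ex : x \in E by rewrite (subsetP sHE) // defH cycle_id.
exists x, y; split; split=> //.
- by rewrite -defH.
- exact: (centsP cEE).
- by case/(abelemP p_pr): abE => _; apply.
- by move=> m fx fy; apply: fixy; rewrite ?defH ?fixed_cycle //; apply: submoduleT.
by move=> m; rewrite try defH trace_cycle.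
Qed.

Lemma delta_lin x a b c i j :
  delta x (a + b *+ i + c *+ j) = delta x a + delta x b *+ i + delta x c *+ j :> M.
Proof. by rewrite !deltaD !deltaMn. Qed.

Lemma mulrn_lin (a b c : M) i j k :
  (a + b *+ i + c *+ j) *+ k = a *+ k + b *+ k *+ i + c *+ k *+ j.
Proof. by rewrite !mulrnDl ![_ *+ _ *+ k]mulrnAC. Qed.

Lemma mulrn_lin2 (a b : M) i j : (a + b *+ i) *+ j = a *+ j + b *+ (i * j).
Proof. by rewrite mulrnDl mulrnA. Qed.

Section Binomial.

Variables (x : qT) (m : M).
Hypothesis x3 : delta x (delta x (delta x m)) = 0.

Lemma gmactX3 i :
  m ^^ (x ^+ i)%g = m + delta x m *+ i + delta x (delta x m) *+ 'C(i, 2).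
Proof.
elim: i => [|i IHi]; first by rewrite gmact1 !mulr0n !addr0.
rewrite expgSr gmactM IHi gmact_delta delta_lin x3 mul0rn addr0.
rewrite binS bin1 mulrnDr mulrSr.
by rewrite addrACA -(addrA m).
Qed.

Lemma ptraceX3 i :
  ptrace x i m = m *+ i + delta x m *+ 'C(i, 2) + delta x (delta x m) *+ 'C(i, 3).
Proof.
elim: i => [|i IHi]; first by rewrite /ptrace big_ord0 !mulr0n !addr0.
rewrite /ptrace big_ord_recr -/(ptrace _ _ _) /= IHi gmactX3 !binS bin1 !mulrnDr mulrSr.
by rewrite addrACA; congr (_ + _); rewrite addrACA.
Qed.

Lemma deltaX3_p : (x ^+ p = 1)%g -> 
  delta x m *+ p + delta x (delta x m) *+ 'C(p, 2) = 0.
Proof.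
by move=> xp; apply: (addrI m); rewrite addrA -gmactX3 xp gmact1 addr0.
Qed.

End Binomial.

Lemma dvd_bin2 : (2 < p)%N -> (p %| 'C(p, 2))%N.
Proof. by move=> p2; apply: prime_dvd_bin. Qed.

Lemma mulrn_dvd m n k : (n %| k)%N -> m *+ n = 0 -> m *+ k = 0.
Proof. by case/dvdnP => d -> mn; rewrite mulnC mulrnA mn mul0rn. Qed.

(** For u = x, y, expanding u^p = 1 gives p (u - 1) + C(p, 2) (u - 1)^2 = 0. If
    (u - 1)^2 = 0 this is p (u - 1) = 0; otherwise p is odd, multiplication by
    u - 1 gives p (u - 1)^2 = 0, and p (u - 1) = 0 because p divides C(p, 2). Of
    the trace of E, which is
      (p + C(p, 2) (y - 1) + C(p, 3) (y - 1)^2) (p + C(p, 2) (x - 1) + ...),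
    there remain p^2 and C(p, 2)^2 (y - 1) (x - 1), and the latter is zero for
    the same reasons. *)
Lemma class3_zero E :
    (p.-abelem E)%g -> #|E| = (p ^ 2)%N -> tate0_trivial E [set: M] ->
    (forall u v w m, delta u (delta v (delta w m)) = 0) ->
    (2 < p)%N \/ (forall u v m, delta u (delta v m) = 0) ->
  forall m, m = 0.
Proof.
move=> abE oE tE d3 p_d2.
have [x [y [[ox sxE Ey _ yp] [fE trE]]]] := abelem2_generators abE oE.
have xp : (x ^+ p = 1)%g by rewrite -ox expg_order.
have pd u m : (u ^+ p = 1)%g -> delta u m *+ p = 0.
  move=> up; have := deltaX3_p (d3 u u u m) up.
  case: p_d2 => [p_odd | ->]; last by rewrite mul0rn addr0.
  rewrite (mulrn_dvd (dvd_bin2 p_odd)) ?addr0 //.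
  by have := deltaX3_p (d3 u u u (delta u m)) up; rewrite d3 mul0rn addr0.
have dd0 : forall m, delta y (delta x m) *+ ('C(p, 2) * 'C(p, 2)) = 0.
  move=> m; case: p_d2 => [p_odd | ->]; last by rewrite mul0rn.
  by apply: mulrn_dvd (pd y _ yp); rewrite dvdn_mulr ?dvd_bin2.
have trE2 m : trace E m = m *+ p *+ p.
  rewrite trE (ptraceX3 (d3 y y y _)) (ptraceX3 (d3 x x x m)).
  rewrite !delta_lin !d3 !mul0rn !addr0 deltaMn.
  rewrite mulrn_lin (pd x m xp) (pd x _ xp) mulrn_lin2 (pd y m yp) dd0.
  by rewrite !delta0 !mul0rn !addr0 mul0rn addr0.
have pfix m : m *+ p \in fixed [set: M] E.
  by apply: fE; apply/eqP; rewrite -delta_eq0 deltaMn; apply/eqP; apply: pd.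
(* p M consists of fixed points, hence of traces, and these lie in p (p M). *)
have pM0 : {in [set m *+ p | m in [set: M]], forall m, m = 0}.
  apply: divisible_zero => _ /imsetP[m _ ->].
  have /imsetP[m' _ ->] := subsetP tE _ (pfix m).
  by exists (m' *+ p); [apply/imsetP; exists m' | apply: trE2].
have /setP T0 : [set: M] = [set 0].
  apply: (fixed_nontrivial p_pr (abelem_pgroup abE)); first by rewrite cardsT.
    exact: submoduleT.
  apply/subsetP => m /(subsetP tE)/imsetP[m' _ ->].
  rewrite trE2 (pM0 (m' *+ p)) ?mul0rn ?set11 //.
  by apply/imsetP; exists m'.
by move=> m; have := T0 m; rewrite !inE => /esym/eqP.
Qed.

(** H^1(E, M) = 0: a crossed homomorphism on E is given by its values e and f at
    x and y, and the hypotheses on e and f are the relations between x and y. As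
    H^-1 of <x> vanishes, e = (x - 1) a; subtracting the principal one of a
    reduces to e = 0. Then f is fixed by x, and H^-1 of E / <x> vanishes on
    the fixed points of x. *)
Lemma crossed_pair_principal x y E (e f : M) :
    #[x]%g = p -> (x * y = y * x)%g -> (y ^+ p = 1)%g ->
    (forall m, m ^^ x = m -> m ^^ y = m -> m \in fixed [set: M] E) ->
    (forall m, trace E m = ptrace y p (ptrace x p m)) ->
    tate0_trivial <[x]>%g [set: M] -> tate0_trivial E [set: M] ->
    ptrace x p e = 0 -> ptrace y p f = 0 -> delta y e = delta x f ->
  exists a, delta x a = e /\ delta y a = f.
Proof.
move=> ox cxy yp fE trE tx tE Ne Nf def_f.
have xp : (x ^+ p = 1)%g by rewrite -ox expg_order.
have zT : zmod_closed [set: M] := (submoduleT M E).1.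
have /imsetP[a _ def_e] : e \in delta x @: [set: M].
  have : e \in [set d in [set: M] | ptrace x p d == 0] by rewrite !inE Ne eqxx.
  apply: subsetP; rewrite -herbrand // => [|d _]; last by rewrite xp gmact1.
  apply/subsetP => d /setIdP[_]; rewrite delta_eq0 => /eqP/fixed_cycle.
  move/(subsetP tx)/imsetP => [m _ ->].
  by rewrite trace_cycle // imset_f.
pose D := [set d : M | delta x d == 0].
have zD : zmod_closed D.
  split=> [|d1 d2]; first by rewrite inE delta0 eqxx.
  by rewrite !inE deltaB => /eqP-> /eqP->; rewrite subrr eqxx.
have /imsetP[b Db def_b] : f - delta y a \in delta y @: D.
  have : f - delta y a \in [set d in D | ptrace y p d == 0].
    rewrite !inE deltaB ptraceB Nf ptrace_delta yp gmact1 !subrr eqxx andbT.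
    by rewrite -def_f def_e (delta_comm a cxy) subrr eqxx.
  apply: subsetP; rewrite -herbrand // => [|d|d _].
  - apply/subsetP => d /setIdP[]; rewrite inE !delta_eq0 => /eqP dx /eqP dy.
    have /imsetP[m _ ->] := subsetP tE d (fE d dx dy).
    by rewrite trE imset_f // inE delta_ptrace xp gmact1 subrr.
  - by rewrite !inE !delta_eq0 -!gmactM -cxy gmactM => /eqP ->.
  by rewrite yp gmact1.
exists (a + b); split; rewrite deltaD; last by rewrite -def_b addrC subrK.
by move: Db; rewrite -def_e inE => /eqP ->; rewrite addr0.
Qed.

(** Let S be the p-torsion of M, F the fixed points of E, L the set of all a with
    (x - 1) a and (y - 1) a in S, and W the set of crossed homomorphisms from E
    to S. They are principal in M, and p L lies in F, so that
    |F| |W| <= |L| <= |F| |S|, that is |W| <= |S|. In S x S, the subgroup W is the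
    kernel of a map to the intersection of S and F; so |S|^2 <= |S| |S :&: F|
    and E acts trivially on S. But then W = S x S, and |S|^2 <= |S|. *)
Lemma quadratic_torsion_zero E :
    (2 < p)%N -> (p.-abelem E)%g -> #|E| = (p ^ 2)%N ->
    (forall H : {group qT}, H \subset E -> tate0_trivial H [set: M]) ->
    (forall u v m, m *+ p = 0 -> delta u (delta v m) = 0) ->
  forall m, m = 0.
Proof.
move=> p2 abE oE tE d2.
have [x [y [[ox sxE Ey cxy yp] [fE trE]]]] := abelem2_generators abE oE.
have xp : (x ^+ p = 1)%g by rewrite -ox expg_order.
have H1 := crossed_pair_principal ox cxy yp fE trE (tE _ sxE) (tE _ (subxx _)).
pose S := [set m : M | m *+ p == 0].
pose F := [set m : M | (delta x m == 0) && (delta y m == 0)].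
pose L := [set m : M | (delta x m \in S) && (delta y m \in S)].
pose W := [set ef in setX S S | delta y ef.1 - delta x ef.2 == 0].
have zS : zmod_closed S.
  split=> [|a b]; first by rewrite inE mul0rn eqxx.
  by rewrite !inE mulrnBl => /eqP -> /eqP ->; rewrite subrr eqxx.
have inL a : (a \in L) = (delta x a \in S) && (delta y a \in S) by rewrite inE.
have S0 : 0 \in S := zS.1.
have SB : {in S &, forall a b, a - b \in S} := zS.2.
have zL : zmod_closed L.
  split=> [|a b]; first by rewrite inL !delta0 S0.
  by rewrite !inL !deltaB => /andP[??] /andP[??]; apply/andP; split; apply: SB.
have zSS : zmod_closed (setX S S).
  split=> [|[a1 a2] [b1 b2]]; first by rewrite in_setX /= S0.
  by rewrite !in_setX /= => /andP[??] /andP[??]; apply/andP; split; apply: SB.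
have S2 u v e : e \in S -> delta u (delta v e) = 0.
  by rewrite inE => /eqP; apply: d2.
have Sd u e : e \in S -> delta u e \in S.
  by rewrite !inE -deltaMn => /eqP ->; rewrite delta0 eqxx.
(* The relations u^p = 1 hold for values in S, since p is odd. *)
have S_ptrace u e : e \in S -> (u ^+ p = 1)%g -> ptrace u p e = 0.
  move=> Se up; have dd := S2 u u e Se.
  rewrite (ptraceX3 (x := u)) dd ?delta0 // mul0rn addr0.
  have ep : e *+ p = 0 by move: Se; rewrite inE => /eqP.
  by rewrite ep add0r (mulrn_dvd (dvd_bin2 p2)) // -deltaMn ep delta0.
(* Multiplication by p maps L to F, with kernel in S. *)
have L1 : (#|L| <= #|S| * #|F|)%N.
  have := card_image_kernel zL (in2W (@mulrnBl M p)).
  move=> ->; apply: leq_mul; apply: subset_leq_card; apply/subsetP.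
    by move=> a /setIdP[_ ap]; rewrite inE.
  move=> _ /imsetP[a La ->].
  by move: La; rewrite !inE !deltaMn.
(* The pair (x - 1, y - 1) maps L onto a set containing W, with kernel F. *)
have L2 : (#|F| * #|W| <= #|L|)%N.
  have := card_image_kernel zL (f := fun a => (delta x a, delta y a)).
  move=> ->; last by move=> a b _ _ /=; rewrite !deltaB.
  apply: leq_mul; apply: subset_leq_card; apply/subsetP.
    move=> a; rewrite !inE => /andP[/eqP ax /eqP ay].
    by rewrite -pair_eqE /= ax ay !mul0rn !eqxx.
  case=> e f; rewrite inE => /andP[/setXP[/= Se Sf]]; rewrite subr_eq0 => /eqP ef.
  have [a [def_e def_f]] := H1 e f (S_ptrace _ _ Se xp) (S_ptrace _ _ Sf yp) ef.
  by apply/imsetP; exists a; rewrite ?inL def_e def_f ?Se.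
pose U := (fun ef : M * M => delta y ef.1 - delta x ef.2) @: setX S S.
have card_SS : (#|S| * #|S| = #|W| * #|U|)%N.
  rewrite -cardsX; apply: card_image_kernel zSS _ => -[a1 a2] [b1 b2] _ _ /=.
  rewrite !deltaB !opprB addrACA [RHS]addrACA.
  by congr (_ + _); apply: addrC.
have F_gt0 : (0 < #|F|)%N.
  by apply/card_gt0P; exists 0; rewrite inE !delta0 eqxx.
have S_gt0 : (0 < #|S|)%N by apply/card_gt0P; exists 0; rewrite S0.
have leWS : (#|W| <= #|S|)%N.
  by rewrite -(leq_pmul2l F_gt0) (leq_trans L2) // mulnC.
have sUSF : U \subset S :&: F.
  apply/subsetP => _ /imsetP[[e f] /setXP[/= Se Sf] ->]; rewrite inE SB ?Sd //=.
  by rewrite inE (deltaB x (delta y e)) (deltaB y (delta y e)) !S2 // subrr !eqxx.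
have sSF : S \subset F.
  apply/setIidPl/eqP; rewrite eqEcard subsetIl /=.
  apply: leq_trans (subset_leq_card sUSF).
  by rewrite -(leq_pmul2l S_gt0) card_SS leq_mul2r leWS orbT.
have U1 : #|U| = 1%N.
  have -> : U = [set 0]; last by rewrite cards1.
  apply/eqP; rewrite eqEsubset sub1set; apply/andP; split.
    apply/subsetP => _ /imsetP[[e f] /setXP[/= /(subsetP sSF) Fe /(subsetP sSF) Ff] ->].
    by move: Fe Ff; rewrite !inE => /andP[_ /eqP ->] /andP[/eqP -> _]; rewrite subrr.
  apply/imsetP; exists (0, 0); rewrite ?zSS.1 //=.
  by rewrite !delta0 subrr.
have S1 : (#|S| <= 1)%N.
  by rewrite -(leq_pmul2l S_gt0) card_SS U1 !muln1.
apply: torsion_free_zero => m mp; apply/set1P.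
have -> : [set 0] = S; last by rewrite inE mp.
by apply/eqP; rewrite eqEcard sub1set S0 cards1.
Qed.

Hypothesis tM : forall K : {group qT}, tate0_trivial K [set: M].
Hypotheses (pQ : (p.-group [set: qT])%g) (ncycQ : ~~ cyclic [set: qT]).

(** The noncyclic p-groups without such a subgroup are the generalized quaternion
    groups, which are neither abelian nor of odd order. *)
Lemma noncyclic_rank2 : (2 < p)%N \/ abelian [set: qT] ->
  exists2 E : {group qT}, (p.-abelem E)%g & #|E| = (p ^ 2)%N.
Proof.
move=> H; suff /p_rank_geP[E]: (1 < 'r_p([set: qT])%g)%N.
  by case/pnElemP => _ abE oE; exists E; rewrite // (card_pgroup (abelem_pgroup abE)) oE.
rewrite ltnNge; apply: contra ncycQ; case: H => [p2 | cQQ].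
  rewrite (odd_pgroup_rank1_cyclic (G := [set: qT]%G) pQ) //.
  have [k ->] := p_natP pQ; rewrite oddX.
  by case: (even_prime p_pr) p2 => [-> // | -> _]; rewrite orbT.
by rewrite (abelian_rank1_cyclic cQQ) (rank_pgroup (G := [set: qT]%G) pQ).
Qed.

Lemma cubic_zero : (2 < p)%N ->
  (forall u v w m, delta u (delta v (delta w m)) = 0) -> forall m, m = 0.
Proof.
move=> p2 d3; have [|E abE oE] := noncyclic_rank2; first by left.
exact: (class3_zero abE oE (tM E) d3 (or_introl p2)).
Qed.

Lemma torsion_quadratic_zero : (2 < p)%N ->
  (forall u v m, m *+ p = 0 -> delta u (delta v m) = 0) -> forall m, m = 0.
Proof.
move=> p2 d2; have [|E abE oE] := noncyclic_rank2; first by left.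
exact: (quadratic_torsion_zero p2 abE oE (fun H _ => tM H) d2).
Qed.

(** If Q is not abelian, the identity
    uv - 1 = (u - 1) + (v - 1) + (u - 1)(v - 1), whose last term vanishes on M,
    shows that uv and vu act in the same way. *)
Lemma quadratic_zero :
  (forall u v m, delta u (delta v m) = 0) -> forall m, m = 0.
Proof.
move=> d2; have d3 u v w m : delta u (delta v (delta w m)) = 0.
  exact: d2.
have [cQQ | ncQQ] := boolP (abelian [set: qT]).
  have [|E abE oE] := noncyclic_rank2; first by right.
  by apply: (class3_zero abE oE (tM E) d3); right.
pose T := [set z : qT | [forall m : M, m ^^ z == m]].
have inT z : reflect (forall m : M, m ^^ z = m) (z \in T).
  by rewrite inE; apply: (iffP forallP) => H m; apply/eqP.
have gT : group_set T.
  apply/group_setP; split=> [|u v /inT Tu /inT Tv]; apply/inT => m.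
    exact: gmact1.
  by rewrite gmactM Tu Tv.
have sQT : ([set: qT]^`(1))%g \subset T.
  rewrite (gen_subG _ (Group gT)); apply/subsetP => _ /imset2P[u v _ _ ->].
  have uv m : m ^^ (u * v)%g = m + delta u m + delta v m.
    by rewrite gmactM gmact_delta (gmact_delta u m) deltaD d2 addr0.
  have vu m : m ^^ (v * u)%g = m ^^ (u * v)%g.
    by rewrite uv gmactM gmact_delta (gmact_delta v m) deltaD d2 addr0 addrAC.
  apply/inT => m; rewrite commgEl conjgE mulgA -invMg gmactM.
  by rewrite -vu -gmactM mulVg gmact1.
have ntQ' : ([set: qT]^`(1))%G :!=: 1%g by apply: contra ncQQ => /eqP/derG1P.
have [_ p_dv _] := pgroup_pdiv (pgroupS (der_sub 1 _) pQ) ntQ'.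
have [z Qz oz] := Cauchy p_pr p_dv.
by apply: (trivial_action_zero oz _ (tM <[z]>)); apply/inT/(subsetP sQT).
Qed.

End RankTwo.
Local Close Scope ring_scope.
Local Open Scope group_scope.

(** * The center of N as a module over G / N *)

Section CenterModule.

Variables (gT : finGroupType) (G N : {group gT}).
Hypothesis nNG : N <| G.

Fact center_sub_fix : 'Z(N) \subset 'C_(|'J)(N).
Proof. by rewrite gacentE ?subsetT // setTI afixJ subsetIr. Qed.

Fact quotient_sub_dom : G / N \subset [set: gT] / N.
Proof. by rewrite quotientS ?subsetT. Qed.

Fact acts_center : {acts (G / N), on 'Z(N) | ('J %% N)%gact}.
Proof.
apply: acts_act; rewrite astabs_mod; last by rewrite astabJ centsC subsetIr.
by rewrite quotientS // astabsJ (subset_trans (normal_norm nNG)) ?gFnorm_trans.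
Qed.

Definition center_module : gmodule (subg_of (G / N)%G) :=
  gmodule_of_action quotient_sub_dom center_sub_fix (center_abelian N) acts_center.

Definition center_val (m : center_module) : gT := sgval (m : subg_of 'Z(N)%G).

Lemma center_valP m : center_val m \in 'Z(N).
Proof. exact: (subgP (m : subg_of 'Z(N)%G)). Qed.

Lemma center_val_inj : injective center_val.
Proof. exact: val_inj. Qed.

Lemma center_valMn m k : center_val (GRing.natmul m k) = center_val m ^+ k.
Proof. by elim: k => // k IHk; rewrite GRing.mulrS expgS -IHk. Qed.

Lemma center_val_act m (x : (subg_of (G / N)%G)) :
  exists2 g, g \in G & center_val (m ^^ x) = center_val m ^ g.
Proof.
have /morphimP[g Ng Gg def_x] : sgval x \in G / N by apply: subgP.
exists g => //; rewrite -(conj_mod_centerE nNG (center_valP m) Gg) -def_x.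
rewrite /center_val /gmact /= /act_M subgK //.
by rewrite acts_center ?(subgP x) //; apply: center_valP.
Qed.

(** As Z(N) is abelian, delta is the commutator with a preimage of x in G. *)
Lemma delta_ucn n m (x : (subg_of (G / N)%G)) :
  center_val m \in 'Z_n.+1(G) -> center_val (delta x m) \in 'Z_n(G).
Proof.
have [g Gg def_mx] := center_val_act m x.
have -> : center_val (delta x m) = [~ center_val m, g].
  by rewrite /delta GRing.addrC commgEl -def_mx.
by move=> Zm; apply: (subsetP (ucn_comm n G)); rewrite mem_commg.
Qed.

Lemma center_val0 m : center_val m \in 'Z_0(G) -> m = 0%R.
Proof. by rewrite ucn0 => /set1P m1; apply: center_val_inj. Qed.

Lemma center_val_ucn m n : 'Z_n(G) = G -> center_val m \in 'Z_n(G).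
Proof.
move->; apply: (subsetP (normal_sub nNG)).
exact: (subsetP (center_sub N)) (center_valP m).
Qed.

End CenterModule.

Lemma p_central_torsion (gT : finGroupType) (p : nat) (G : {group gT}) a :
  p_central p (G / 'Z(G)) -> a \in G -> a ^+ p = 1 -> a \in 'Z_2(G).
Proof.
case/andP=> pGZ /eqP Ohm1Z Ga ap; rewrite ucnSn ucn1.
have Na : a \in 'N('Z(G)) by apply: (subsetP (gFnorm _ G)).
rewrite mem_morphpre //; apply: (subsetP (Ohm_sub 1 _)); rewrite -Ohm1Z.
rewrite (OhmE 1 pGZ) mem_gen // !inE mem_quotient //.
by rewrite expn1 -morphX //= ap morph1.
Qed.

Theorem theorem3p6 (gT : finGroupType) (p : nat) (G N : {group gT})
    (p_prime : prime p) (pG : p.-group G)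
    (normN : N <| G) (ntN : N :!=: 1) (ncycGN : ~~ cyclic (G / N))
    (hG : (2 < p /\
             (nil_class_le 2 (G / 'Z(G)) \/ p_central p (G / 'Z(G))))
          \/ nil_class_le 2 G) :
  forall n : nat,
    tate_cohomology ('J %% N)%gact (G / N)%G 'Z(N)%G n != 1.
Proof.
move=> n; apply/eqP => Hn; case/eqP: ntN.
have pN := pgroupS (normal_sub normN) pG.
apply: (trivg_center_pgroup pN); apply/trivgP/subsetP => a Za.
pose M := center_module normN.
suff M0 (m : M) : m = 0%R.
  have := congr1 (@center_val _ _ _ normN) (M0 (subg 'Z(N)%G a)).
  by rewrite /center_val subgK // => ->; apply/set1P.
have pM : p.-nat #|M|.
  have := pgroupS (center_sub N) pN.
  by rewrite /pgroup (card_isog (isog_subg 'Z(N)%G)) cardsT.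
have iso := isog_subg (G / N)%G.
have pQ : p.-group [set: (subg_of (G / N)%G)] by rewrite -(isog_pgroup p iso) quotient_pgroup.
have ncQ : ~~ cyclic [set: (subg_of (G / N)%G)] by rewrite -(isog_cyclic iso).
have tM (K : {group subg_of (G / N)%G}) : tate0_trivial K [set: M].
  apply: tate0_of_hdiff p_prime pM pQ _.
  exact: tate0_of_tate_cohomology Hn.
have nilG := pgroup_nil pG.
case: hG => [[p2 [/andP[_ cG] | pcG]] | /andP[_ cG]].
- have Z3 : 'Z_3(G) = G.
    apply/(ucn_nil_classP 3 nilG); move: cG.
    by rewrite nil_class_quotient_center //; case: (nil_class G).
  apply: (cubic_zero p_prime pM tM pQ ncQ p2) => u v w {}m.
  by apply: center_val0; do 3!apply: delta_ucn; apply: center_val_ucn.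
- apply: (torsion_quadratic_zero p_prime pM tM pQ ncQ p2) => u v {}m mp.
  apply: center_val0; do 2!apply: delta_ucn.
  apply: (p_central_torsion pcG).
    by apply: (subsetP (normal_sub normN)); case/setIP: (center_valP m).
  by rewrite -center_valMn mp.
have Z2 : 'Z_2(G) = G by apply/(ucn_nil_classP 2 nilG).
apply: (quadratic_zero p_prime pM tM pQ ncQ) => u v {}m.
by apply: center_val0; do 2!apply: delta_ucn; apply: center_val_ucn.
Qed.
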